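(* Let $0<p\leq 1$. Let $\mathcal{A}$ be a unital Banach algebra, $\omega$ a weight on $\mathbb{Z}$, $f \in C(\mathbb{T},\mathcal{A})$, and suppose $f$ has $p$-th power $\omega$-absolutely convergent Fourier series. If $f(z)$ is left invertible (respectively, right invertible, invertible) in $\mathcal A$ for all $z \in \mathbb{T}$, then there exist a weight $\nu$ on $\mathbb{Z}$ and $g \in C(\mathbb{T},\mathcal{A})$ such that (i) $1 \leq \nu \leq \omega$; (ii) $\nu$ is constant if and only if $\omega$ is constant; (iii) $g$ has $p$-th power $\nu$-absolutely convergent Fourier series; (iv) $g$ is a left inverse (respectively, right inverse, inverse) of $f$. In particular, if $\omega$ is an admissible weight, then a left inverse (respectively, right inverse, inverse) of $f$ has $p$-th power $\omega$-absolutely convergent Fourier series.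
   Context: All algebras are complex. $\mathbb{T}=\{z\in\mathbb{C}:|z|=1\}$; $C(\mathbb{T},\mathcal{A})$ is the set of continuous functions $\mathbb{T}\to\mathcal{A}$ (an algebra under pointwise operations; inverses of $f$ are with respect to pointwise multiplication). $\|\cdot\|$ is the norm of $\mathcal{A}$. A weight on $\mathbb{Z}$ is a map $\omega:\mathbb{Z}\to[1,\infty)$ with $\omega(m+n)\leq\omega(m)\omega(n)$ for all $m,n\in\mathbb{Z}$. Put $\rho_{1,\omega}=\sup\{\omega(-n)^{-1/n}:n\in\mathbb{N}\}$ and $\rho_{2,\omega}=\inf\{\omega(n)^{1/n}:n\in\mathbb{N}\}$, $\mathbb N=\{1,2,\dots\}$; $\omega$ is admissible if $\rho_{1,\omega}=1=\rho_{2,\omega}$. The Fourier coefficients of $f\in C(\mathbb{T},\mathcal{A})$ are $\widehat f(n)=\frac{1}{2\pi}\int_0^{2\pi}f(e^{it})e^{-int}\,dt\in\mathcal{A}$ ($n\in\mathbb{Z}$). For $0<p<\infty$, $f\in C(\mathbb{T},\mathcal{A})$ has $p$-th power $\omega$-absolutely convergent Fourier series if $f(z)=\sum_{n\in\mathbb{Z}}\widehat f(n)z^n$ for all $z\in\mathbb{T}$ and $\sum_{n\in\mathbb{Z}}\|\widehat f(n)\|^p\omega(n)^p<\infty$. *)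

(* Defs.v *)
From HB Require Import structures.
From mathcomp Require Import all_boot all_order all_algebra.
From mathcomp Require Import all_classical all_reals all_analysis.
From mathcomp Require Export complex.

Set Implicit Arguments.
Unset Strict Implicit.
Unset Printing Implicit Defensive.

Import Order.TTheory GRing.Theory Num.Theory numFieldNormedType.Exports.

Local Open Scope classical_set_scope.
Local Open Scope ring_scope.
Local Open Scope complex_scope.

(* MathComp-Analysis has no normed algebras, and HB rejects the join of
   CompleteNormedModule and GRing.Algebra (missing join of GRing.PzSemiRing and
   Num.SemiNormedZmodule below Num.NumDomain), so the multiplication is carried
   by a dedicated mixin. The normalization `|bone| = 1 is not required. *)
HB.mixin Record CompleteNormedModule_isBanachAlgebra (K : numFieldType) A
    of CompleteNormedModule K A := {
  bone : A ;
  bmul : A -> A -> A ;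
  bmulA : associative bmul ;
  bmul1x : left_id bone bmul ;
  bmulx1 : right_id bone bmul ;
  bmulDl : left_distributive bmul +%R ;
  bmulDr : right_distributive bmul +%R ;
  bscalerAl : forall (a : K) (x y : A), a *: bmul x y = bmul (a *: x) y ;
  bscalerAr : forall (a : K) (x y : A), a *: bmul x y = bmul x (a *: y) ;
  normr_bmul : forall x y : A, `|bmul x y| <= `|x| * `|y|
}.

#[short(type="unitalBanachAlgType")]
HB.structure Definition UnitalBanachAlgebra (K : numFieldType) :=
  {A of CompleteNormedModule K A & CompleteNormedModule_isBanachAlgebra K A}.

Inductive side := LeftSide | RightSide | TwoSided.

Definition is_inverse (K : numFieldType) (A : unitalBanachAlgType K)
    (s : side) (x y : A) : Prop :=
  match s with
  | LeftSide => bmul y x = bone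
  | RightSide => bmul x y = bone
  | TwoSided => bmul y x = bone /\ bmul x y = bone
  end.

Definition is_invertible (K : numFieldType) (A : unitalBanachAlgType K)
    (s : side) (x : A) : Prop :=
  exists y : A, is_inverse s x y.

Section Weights.
Context {R : realType}.
Implicit Type w : int -> R.

Definition weight w : Prop :=
  (forall n, 1 <= w n) /\ (forall m n, w (m + n) <= w m * w n).

Definition rho1 w : R :=
  sup [set w (- n%:Z) `^ (- n%:R^-1) | n in [set n : nat | (0 < n)%N]].

Definition rho2 w : R :=
  inf [set w n%:Z `^ n%:R^-1 | n in [set n : nat | (0 < n)%N]].

Definition admissible w : Prop := rho1 w = 1 /\ rho2 w = 1.

Definition constant_weight w : Prop := exists c : R, forall n, w n = c.

End Weights.

Section Fourier.
Context {R : realType}.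

(* The norm of a normed module over R[i] takes its (real) values in R[i]. *)
Definition rnorm {V : normedModType R[i]} (x : V) : R := complex.Re `|x|.

Definition riemann_sum {V : normedModType R[i]} (F : R -> V)
    (a : R) (s : seq R) (xi : nat -> R) : V :=
  \sum_(i < size s) (s`_i - (a :: s)`_i)%:C *: F (xi i).

(* Riemann integral of a vector-valued function: a :: s lists the points of a
   partition of [a, b] and the xi i are the tags. *)
Definition is_riemann_integral {V : normedModType R[i]} (F : R -> V)
    (a b : R) (I : V) : Prop :=
  forall e : R, 0 < e -> exists2 d : R, 0 < d &
    forall (s : seq R) (xi : nat -> R), itv_partition a b s ->
      (forall i, (i < size s)%N ->
         s`_i - (a :: s)`_i < d /\ (a :: s)`_i <= xi i <= s`_i) ->
      rnorm (riemann_sum F a s xi - I) < e.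

Definition riemann_integral {V : normedModType R[i]} (F : R -> V)
    (a b : R) : V :=
  xget 0 [set I | is_riemann_integral F a b I].

Definition circle : set R[i] := [set z | `|z| = 1].

Definition expi (t : R) : R[i] := cos t +i* sin t.

(* An element of C(T, A) is represented by a function on R[i], of which only the
   values on the circle matter. R[i]^o carries the topology of the modulus. *)
Definition continuous_on_circle {V : normedModType R[i]} (f : R[i] -> V) : Prop :=
  {within (circle : set R[i]^o), continuous (f : R[i]^o -> V)}.

Definition fourier_coef {V : normedModType R[i]} (f : R[i] -> V) (n : int) : V :=
  ((2 * pi)^-1)%:C *:
  riemann_integral (fun t => expi (- (n%:~R * t)) *: f (expi t)) 0 (2 * pi).

Definition fourier_partial_sum {V : normedModType R[i]} (f : R[i] -> V)
    (z : R[i]) (N : nat) : V :=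
  \sum_(k < N.*2.+1) z ^ (k%:Z - N%:Z) *: fourier_coef f (k%:Z - N%:Z).

(* The pointwise convergence of the two-sided Fourier series is that of its
   symmetric partial sums; for p <= 1 and w >= 1 the summability condition
   makes the series absolutely convergent, hence independent of this choice. *)
Definition p_abs_conv_fourier {V : normedModType R[i]} (p : R) (w : int -> R)
    (f : R[i] -> V) : Prop :=
  (forall z, circle z -> fourier_partial_sum f z @ \oo --> f z) /\
  (\esum_(n in [set: int]) ((rnorm (fourier_coef f n) `^ p) * (w n `^ p))%:E
     < +oo)%E.

End Fourier.

(* Main.v *)
(* Everything is done on Laurent polynomials, with pn x = |x|^p, which is
   p-subadditive and submultiplicative.

   Since f has approximate left inverses bounded uniformly on the circle, Fejer
   interpolation at the M-th roots of unity glues them into a Laurent polynomial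
   q with |1 - q f| <= 3/4 on the circle.  Write f = f_N + r with f_N a truncated
   Fourier series, so that h = 1 - q f = h0 - q r, with h0 = 1 - q f_N a Laurent
   polynomial.  The Fourier coefficients r_n of r are constants and z^n is
   central, so h^k expands into words in h0 and the q r_n, each of them a
   Laurent polynomial of degree at most k d times a monomial.  A Laurent
   polynomial of degree D has at most 2 D + 1 coefficients, each bounded by its
   sup norm; hence the weighted l^p mass of h^k is at most
     K sigma^(d k) (sup pn h0 + (sup pn q) sum_n pn r_n nu(n)^p)^k
   as soon as nu grows at most like s^|n| with s close enough to 1, and the
   Neumann series of h, applied to q, gives the left inverse.

   If w has subexponential growth (in particular if it is admissible or
   constant), take nu = w.  Otherwise w dominates r^n for n >= 0, or its mirror
   image, for some r > 1, and nu is a one-sided exponential of small rate.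
   Right inverses come from the opposite algebra. *)
Require Import Defs.
From HB Require Import structures.
From mathcomp Require Import all_boot all_order all_algebra.
From mathcomp Require Import all_classical all_reals all_analysis.
From mathcomp Require Import ring lra zify.

Set Implicit Arguments.
Unset Strict Implicit.
Unset Printing Implicit Defensive.

Import Order.TTheory GRing.Theory Num.Theory numFieldNormedType.Exports.

Local Open Scope classical_set_scope.
Local Open Scope ring_scope.
Local Open Scope complex_scope.

(** * Norms and the unit circle *)

Section RealNorm.
Context {R : realType} {V : normedModType R[i]}.
Implicit Types (x y : V) (z : R[i]).

(** Convertible to [rnorm] on [R[i]^o], so that vector-valued lemmas such as [rnorm_sum] also apply
    to scalars. *)
Definition cabs z : R := complex.Re `|z|.

Lemma cabsE z : (cabs z)%:C = `|z|.
Proof. by rewrite /cabs normc_def. Qed.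

Lemma rnormE x : (rnorm x)%:C = `|x|.
Proof.
rewrite /rnorm; have : 0 <= `|x| by [].
by case: `|x| => a b /=; rewrite lecE /= => /andP[/eqP -> _].
Qed.

Lemma rnorm_ge0 x : 0 <= rnorm x.
Proof. by rewrite -ler0c rnormE. Qed.

Lemma cabs_ge0 z : 0 <= cabs z.
Proof. by rewrite -ler0c cabsE. Qed.

Lemma rnorm0 : rnorm (0 : V) = 0.
Proof. by rewrite /rnorm normr0. Qed.

Lemma rnorm_eq0 x : rnorm x = 0 -> x = 0.
Proof. by move=> x0; apply/normr0_eq0; rewrite -rnormE x0. Qed.

Lemma rnormN x : rnorm (- x) = rnorm x.
Proof. by rewrite /rnorm normrN. Qed.

Lemma rnormB x y : rnorm (x - y) = rnorm (y - x).
Proof. by rewrite -rnormN opprB. Qed.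

Lemma rnormD x y : rnorm (x + y) <= rnorm x + rnorm y.
Proof. by rewrite -lecR rmorphD /= !rnormE ler_normD. Qed.

Lemma rnorm_dist y x w : rnorm (x - w) <= rnorm (x - y) + rnorm (y - w).
Proof. by rewrite (le_trans _ (rnormD _ _))// addrA subrK. Qed.

Lemma rnormZ z x : rnorm (z *: x) = cabs z * rnorm x.
Proof. by apply: complexI; rewrite rmorphM /= cabsE !rnormE normrZ. Qed.

Lemma rnorm_sum I (r : seq I) (P : pred I) (F : I -> V) :
  rnorm (\sum_(i <- r | P i) F i) <= \sum_(i <- r | P i) rnorm (F i).
Proof.
elim/big_rec2: _ => [|i a b _ ba]; first by rewrite rnorm0.
by rewrite (le_trans (rnormD _ _))// lerD2l.
Qed.

Lemma cabsM z1 z2 : cabs (z1 * z2) = cabs z1 * cabs z2.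
Proof. by apply: complexI; rewrite rmorphM /= !cabsE normrM. Qed.

Lemma cabsD z1 z2 : cabs (z1 + z2) <= cabs z1 + cabs z2.
Proof. by rewrite -lecR rmorphD /= !cabsE ler_normD. Qed.

Lemma cabsN z : cabs (- z) = cabs z.
Proof. by rewrite /cabs normrN. Qed.

Lemma cabs0 : cabs 0 = 0.
Proof. by rewrite /cabs normr0. Qed.

Lemma cabs1 : cabs 1 = 1.
Proof. by rewrite /cabs normr1. Qed.

Lemma cabsR (a : R) : cabs a%:C = `|a|.
Proof. by apply: complexI; rewrite cabsE normc_def /= expr0n /= addr0 sqrtr_sqr. Qed.

Lemma cabsV z : cabs z^-1 = (cabs z)^-1.
Proof. by apply: complexI; rewrite fmorphV /= !cabsE normfV. Qed.

Lemma cabs_i : cabs ('i%C : R[i]) = 1.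
Proof.
by apply: complexI; rewrite cabsE normc_def /= expr0n /= expr1n add0r sqrtr1.
Qed.

Lemma cabs_le_ReIm z : cabs z <= `|complex.Re z| + `|complex.Im z|.
Proof.
rewrite [z in cabs z]complexE (le_trans (cabsD _ _))// cabsM !cabsR.
by rewrite cabs_i mul1r.
Qed.

Lemma circleP z : circle z <-> cabs z = 1.
Proof.
rewrite /circle /=; split => [z1|z1]; first by rewrite /cabs z1.
by rewrite -cabsE z1.
Qed.

Lemma circle_neq0 z : circle z -> z != 0.
Proof. by rewrite /circle /= -normr_eq0 => ->; rewrite oner_eq0. Qed.

Lemma circleM z1 z2 : circle z1 -> circle z2 -> circle (z1 * z2).
Proof. by rewrite !circleP cabsM => -> ->; rewrite mulr1. Qed.

Lemma circleV z : circle z -> circle z^-1.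
Proof. by rewrite !circleP cabsV => ->; rewrite invr1. Qed.

Lemma circle1 : circle (1 : R[i]).
Proof. by rewrite /circle /= normr1. Qed.

Lemma circleX z (n : int) : circle z -> circle (z ^ n).
Proof.
move=> z1; have H k : circle (z ^+ k).
  by elim: k => [|k IH]; rewrite ?expr0 ?exprS; [exact: circle1|exact: circleM].
by case: n => n; [exact: H|apply: circleV; exact: H].
Qed.

Lemma rnormZ_circle z x : circle z -> rnorm (z *: x) = rnorm x.
Proof. by rewrite circleP rnormZ => ->; rewrite mul1r. Qed.

Lemma circle_expi (t : R) : circle (expi t).
Proof. by rewrite /circle /= normc_def /= cos2Dsin2 sqrtr1. Qed.

Lemma expiD (s t : R) : expi (s + t) = expi s * expi t.
Proof.
rewrite /expi cosD sinD; apply/eqP; rewrite eq_complex /= eqxx /=.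
by apply/eqP; rewrite addrC mulrC [X in _ + X]mulrC [in RHS]mulrC; ring.
Qed.

Lemma expi0 : expi (0 : R) = 1.
Proof. by rewrite /expi cos0 sin0. Qed.

Lemma expiN (t : R) : expi (- t) = (expi t)^-1.
Proof.
apply: (mulIf (circle_neq0 (circle_expi t))).
rewrite mulVf; last exact/circle_neq0/circle_expi.
by rewrite -expiD addNr expi0.
Qed.

Lemma expiXz (n : int) (t : R) : expi t ^ n = expi (n%:~R * t).
Proof.
have H k : expi t ^+ k = expi (k%:R * t).
  elim: k => [|k IH]; first by rewrite mul0r expi0 expr0.
  by rewrite exprS IH -expiD -natr1 mulrDl mul1r addrC.
by case: n => n; rewrite /exprz H// NegzE mulrNz mulNr expiN.
Qed.

Lemma expi2pi (n : int) : expi (n%:~R * (2 * pi)) = (1 : R[i]).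
Proof.
rewrite -expiXz /expi; suff -> : (cos (2 * pi) +i* sin (2 * pi) : R[i]) = 1.
  by rewrite exp1rz.
by rewrite mulrC mulr_natr cos2pi sin2pi.
Qed.

End RealNorm.

#[local] Hint Resolve circle_expi : core.

(** * Riemann integrals *)

Section Convergence.
Context {R : realType}.

(** In the order of [R[i]], comparable elements have equal imaginary parts. The radii of the
    topology are therefore real, and limits can be restated with [rnorm]. *)
Lemma gt0_complex (e : R[i]) : 0 < e -> exists2 r : R, 0 < r & e = r%:C.
Proof.
case: e => a b; rewrite ltcE /= => /andP[/eqP b0 a0]; exists a => //.
by rewrite b0.
Qed.

Lemma cvg_rnormP {V : normedModType R[i]} (u : nat -> V) (l : V) :
  (u @ \oo --> l) <->
  (forall e : R, 0 < e -> exists N, forall n, (N <= n)%N -> rnorm (u n - l) < e).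
Proof.
split.
  move=> /cvgrPdist_lt ul e e0.
  have ec0 : 0 < e%:C by rewrite ltcR.
  have [N _ HN] := ul _ ec0; exists N => n Nn.
  by have := HN n Nn; rewrite /= -rnormE ltcR rnormB.
move=> H; apply/cvgrPdist_lt => _ /gt0_complex[e e0 ->].
have [N HN] := H _ e0; exists N => // n /= Nn.
by rewrite -rnormE ltcR rnormB; exact: HN.
Qed.

Lemma rnorm_cauchy_cvg {V : completeNormedModType R[i]} (u : nat -> V) :
  (forall e : R, 0 < e -> exists N, forall m n, (N <= m)%N -> (N <= n)%N ->
     rnorm (u m - u n) < e) ->
  exists l, forall e : R, 0 < e ->
    exists N, forall n, (N <= n)%N -> rnorm (u n - l) < e.
Proof.
move=> H; have /cauchy_cvgP/cvg_ex[l ul] : cauchy (u @ \oo).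
  apply/cauchy_exP => _ /gt0_complex[e e0 ->].
  have [N HN] := H _ e0; exists (u N); exists N => // n /= Nn.
  by rewrite -ball_normE /ball_ /= -rnormE ltcR; exact: HN.
by exists l; apply/cvg_rnormP.
Qed.

End Convergence.

Section RiemannIntegral.
Context {R : realType} {V : normedModType R[i]}.
Implicit Types (F G : R -> V) (a b : R) (s : seq R) (xi : nat -> R).

Definition tagged a s xi (d : R) := forall i, (i < size s)%N ->
  s`_i - (a :: s)`_i < d /\ (a :: s)`_i <= xi i <= s`_i.

Lemma sum_partition (W : zmodType) (g : R -> W) a b s : itv_partition a b s ->
  \sum_(i < size s) (g s`_i - g (a :: s)`_i) = g b - g a.
Proof.
elim: s a => [|x s IH] a ps.
  by rewrite big_ord0 (itv_partition_nil ps) subrr.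
rewrite /= big_ord_recl /= (IH x); last exact: itv_partition_cons ps.
by rewrite addrC addrA subrK.
Qed.

Lemma partition_lt a b s i : itv_partition a b s -> (i < size s)%N ->
  (a :: s)`_i < s`_i.
Proof. by move=> [/(pathP 0) H _] /H. Qed.

(** The uniform subdivision, tagged at left endpoints. Arbitrarily fine partitions must exist for
    the Riemann integral to be unique and bounded by its integrand. *)
Lemma fine_partition a b (d : R) : a < b -> 0 < d -> exists s : seq R,
  itv_partition a b s /\ tagged a s (fun i => (a :: s)`_i) d.
Proof.
move=> ab d0; have ba0 : 0 < b - a by rewrite subr_gt0.
pose n := (Num.bound ((b - a) / d)).+1.
have n0 : 0 < n%:R :> R by rewrite ltr0n.
have hd : (b - a) / n%:R < d.
  rewrite ltr_pdivrMr// mulrC -ltr_pdivrMr//.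
  have := archi_boundP (ltW (divr_gt0 ba0 d0)) => /lt_le_trans; apply.
  by rewrite ler_nat.
pose g k : R := a + (b - a) / n%:R * k%:R.
have gS k : g k.+1 - g k = (b - a) / n%:R by rewrite /g -natr1; ring.
pose s := mkseq (g \o succn) n.
have ns i : (i < n)%N -> s`_i = g i.+1 by move=> ik; rewrite nth_mkseq.
have nas i : (i <= n)%N -> (a :: s)`_i = g i.
  by case: i => [|i] ik /=; [rewrite /g mulr0 addr0|rewrite ns].
have sz : size s = n by rewrite size_mkseq.
exists s; split; first split.
- apply/(pathP 0) => i; rewrite sz => ik.
  by rewrite nas ?(ltnW ik)// ns// -subr_gt0 gS divr_gt0.
- rewrite (last_nth 0) sz nas// /g divfK ?lt0r_neq0//. by rewrite addrC subrK.
- move=> i; rewrite sz => ik; rewrite nas ?(ltnW ik)// ns// gS; split => //.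
  by rewrite lexx/= -subr_ge0 gS ltW// divr_gt0.
Qed.

Lemma eq_is_riemann_integral F G a b I : F =1 G ->
  is_riemann_integral F a b I -> is_riemann_integral G a b I.
Proof. by move=> /funext ->. Qed.

Lemma riemann_sumD F G a s xi :
  riemann_sum (fun t => F t + G t) a s xi =
  riemann_sum F a s xi + riemann_sum G a s xi.
Proof. by rewrite -big_split/=; apply: eq_bigr => i _; rewrite scalerDr. Qed.

Lemma riemann_sumZ (c : R[i]) F a s xi :
  riemann_sum (fun t => c *: F t) a s xi = c *: riemann_sum F a s xi.
Proof.
by rewrite scaler_sumr; apply: eq_bigr => i _; rewrite !scalerA mulrC.
Qed.

Lemma riemann_sum_bound F a b s xi (M : R) : itv_partition a b s ->
  (forall t, rnorm (F t) <= M) ->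
  rnorm (riemann_sum F a s xi) <= (b - a) * M.
Proof.
move=> ps FM; rewrite (le_trans (rnorm_sum _ _ _))//.
rewrite -(sum_partition id ps) mulr_suml ler_sum// => i _.
have := partition_lt ps (ltn_ord i); rewrite -subr_gt0 => i0.
by rewrite rnormZ cabsR gtr0_norm// ler_wpM2l// ltW.
Qed.

Lemma is_riemann_integral_bound F a b I (M : R) : a < b ->
  is_riemann_integral F a b I -> (forall t, rnorm (F t) <= M) ->
  rnorm I <= (b - a) * M.
Proof.
move=> ab FI FM; apply/ler_addgt0Pr => e e0.
have [d d0 H] := FI _ e0; have [s [ps ts]] := fine_partition ab d0.
have := ltW (H s _ ps ts) => {}H.
rewrite -[I](subrK (riemann_sum F a s (nth 0 (a :: s)))) addrC.
rewrite (le_trans (rnormD _ _))// lerD// 1?rnormB//.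
exact: riemann_sum_bound.
Qed.

Lemma is_riemann_integralD F G a b I J :
  is_riemann_integral F a b I -> is_riemann_integral G a b J ->
  is_riemann_integral (fun t => F t + G t) a b (I + J).
Proof.
move=> FI GJ e e0; have e20 : 0 < e / 2 by rewrite divr_gt0.
have [d1 d10 H1] := FI _ e20; have [d2 d20 H2] := GJ _ e20.
exists (Num.min d1 d2); first by rewrite lt_min d10.
move=> s xi ps ts; rewrite riemann_sumD opprD addrACA.
rewrite (le_lt_trans (rnormD _ _))// (splitr e) ltrD//.
- by apply: H1 => // i si; have [] := ts _ si; rewrite lt_min => /andP[].
- by apply: H2 => // i si; have [] := ts _ si; rewrite lt_min => /andP[].
Qed.

Lemma is_riemann_integralZ (c : R[i]) F a b I :
  is_riemann_integral F a b I ->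
  is_riemann_integral (fun t => c *: F t) a b (c *: I).
Proof.
move=> FI e e0; have c0 : 0 < cabs c + 1 by rewrite ltr_wpDl// cabs_ge0.
have [d d0 H] := FI _ (divr_gt0 e0 c0); exists d => // s xi ps ts.
rewrite riemann_sumZ -scalerBr rnormZ.
have := H _ _ ps ts; rewrite ltr_pdivlMr// mulrC; apply: le_lt_trans.
by rewrite ler_wpM2r ?rnorm_ge0// lerDl.
Qed.

Lemma is_riemann_integral_cst (v : V) a b :
  is_riemann_integral (fun=> v) a b ((b - a)%:C *: v).
Proof.
(* Every Riemann sum of a constant telescopes to the exact value, so any mesh will do. *)
move=> e e0; exists 1 => // s xi ps _.
rewrite /riemann_sum -scaler_suml -rmorph_sum (sum_partition id ps) subrr.
by rewrite rnorm0.
Qed.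

(** [I - J] is an integral of the zero function, hence has norm at most 0. *)
Lemma is_riemann_integral_unique F a b I J : a < b ->
  is_riemann_integral F a b I -> is_riemann_integral F a b J -> I = J.
Proof.
move=> ab FI FJ; apply/eqP; rewrite -subr_eq0; apply/eqP/rnorm_eq0/eqP.
rewrite eq_le rnorm_ge0 andbT.
have := is_riemann_integralD FI (is_riemann_integralZ (-1) FJ).
move=> /(is_riemann_integral_bound (M := 0) ab); rewrite mulr0 scaleN1r.
by apply=> t; rewrite scaleN1r subrr rnorm0.
Qed.

Lemma riemann_integralE F a b I : a < b ->
  is_riemann_integral F a b I -> riemann_integral F a b = I.
Proof.
move=> ab FI; rewrite /riemann_integral; case: xgetP => [J _ FJ|/(_ I)] //.
exact: is_riemann_integral_unique FJ FI.
Qed.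

End RiemannIntegral.

Section RiemannIntegralComplete.
Context {R : realType} {V : completeNormedModType R[i]}.
Implicit Types (F G : R -> V) (a b : R).

(** The integrals of uniform approximants form a Cauchy sequence by the sup bound, and [V] is
    complete; an [e / 3] argument shows that their limit integrates [F]. Integrability of series is
    obtained from this. *)
Lemma is_riemann_integral_limit F a b : a < b ->
  (forall e : R, 0 < e -> exists G J, is_riemann_integral G a b J /\
     forall t, rnorm (F t - G t) <= e) ->
  exists I, is_riemann_integral F a b I.
Proof.
move=> ab H; have ba0 : 0 < b - a by rewrite subr_gt0.
have Hn n : exists GJ : (R -> V) * V, is_riemann_integral GJ.1 a b GJ.2 /\
     forall t, rnorm (F t - GJ.1 t) <= n.+1%:R^-1.
  by have [|G [J ?]] := H n.+1%:R^-1; [rewrite invr_gt0|exists (G, J)].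
have {Hn}[GJ GJP] := choice Hn.
have small (e : R) : 0 < e -> exists N, forall n, (N <= n)%N -> n.+1%:R^-1 < e.
  move=> e0; exists (Num.bound e^-1) => n Nn.
  rewrite invf_plt ?posrE// (lt_le_trans (archi_boundP _))//.
    by rewrite invr_ge0 ltW.
  by rewrite ler_nat (leq_trans Nn).
have [|I HI] := @rnorm_cauchy_cvg _ _ (fun n => (GJ n).2).
  move=> e e0.
  have [|N HN] := small (e / (b - a) / 2); first by rewrite !divr_gt0.
  exists N => m n Nm Nn.
  have [[Gm Fm] [Gn Fn]] := (GJP m, GJP n).
  have := is_riemann_integralD Gm (is_riemann_integralZ (-1) Gn).
  move=> /(is_riemann_integral_bound (M := m.+1%:R^-1 + n.+1%:R^-1) ab).
  rewrite scaleN1r => mn; apply: le_lt_trans (mn _) _ => [t|].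
    rewrite scaleN1r (le_trans (rnorm_dist (F t) _ _))// lerD//.
    by rewrite rnormB.
  rewrite mulrC -ltr_pdivlMr// [ltRHS]splitr.
  by rewrite ltrD//; exact: HN.
exists I => e e0; have e30 : 0 < e / 3 by rewrite divr_gt0.
have [N1 HN1] := HI _ e30.
have [|N2 HN2] := small (e / 3 / (b - a)); first by rewrite !divr_gt0.
pose n := maxn N1 N2; have [Gn Fn] := GJP n.
have [d d0 Hd] := Gn _ e30; exists d => // s xi ps ts.
have -> : e = e / 3 + e / 3 + e / 3 by field.
rewrite (le_lt_trans (rnorm_dist (GJ n).2 _ _))// ltrD//; last first.
  by apply: HN1; rewrite leq_maxl.
rewrite (le_lt_trans (rnorm_dist (riemann_sum (GJ n).1 a s xi) _ _))//.
rewrite ler_ltD//; last exact: Hd.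
rewrite -scaleN1r -riemann_sumZ -riemann_sumD.
rewrite (le_trans (riemann_sum_bound (M := n.+1%:R^-1) _ ps _))//.
  by move=> t; rewrite scaleN1r.
rewrite mulrC -ler_pdivlMr//; apply/ltW/HN2.
by rewrite leq_maxr.
Qed.

End RiemannIntegralComplete.

(** * Integrals of exponentials over a period *)

Section ExponentialIntegral.
Context {R : realType}.
Implicit Types (x y t : R).

Lemma mvt_any_order (f df : R -> R) x y :
  (forall t, is_derive t (1 : R) f (df t)) ->
  exists2 c, `|c - x| <= `|y - x| & f y - f x = df c * (y - x).
Proof.
move=> fdf; have cf : continuous f.
  by move=> t; apply/differentiable_continuous/derivable1_diffP; case: (fdf t).
have [xy|yx|->] := ltgtP x y; last by exists y; rewrite ?subrr ?mulr0.
- have [|c] := @MVT _ f df x y xy (fun t _ => fdf t).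
    exact: continuous_subspaceT.
  rewrite in_itv /= => /andP[xc cy] ->; exists c => //.
  by rewrite !ger0_norm ?subr_ge0 ?(ltW xc) ?(ltW xy)// lerD2r ltW.
- have [|c] := @MVT _ f df y x yx (fun t _ => fdf t).
    exact: continuous_subspaceT.
  rewrite in_itv /= => /andP[yc cx] E; exists c.
    by rewrite !ler0_norm ?subr_le0 ?(ltW cx) ?(ltW yx)// !opprB lerD2l lerN2 ltW.
  by rewrite -opprB E -mulrN opprB.
Qed.

Lemma sin_lipschitz x y : `|sin y - sin x| <= `|y - x|.
Proof.
have [t _ ->] := mvt_any_order (f := sin) (df := cos) x y (fun t => is_derive_sin t).
rewrite normrM ler_piMl// ler_norml cos_geN1 cos_le1 //.
Qed.

Lemma cos_lipschitz x y : `|cos y - cos x| <= `|y - x|.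
Proof.
have [t _ ->] := mvt_any_order (f := cos) x y (fun t => is_derive_cos t).
by rewrite normrM normrN ler_piMl// ler_norml sin_geN1 sin_le1.
Qed.

Lemma expi_lipschitz x y : cabs (expi y - expi x) <= 2 * `|y - x|.
Proof.
rewrite (le_trans (cabs_le_ReIm _))//= mulr_natl mulr2n.
by rewrite lerD ?sin_lipschitz ?cos_lipschitz.
Qed.

(** The cosine and the sine have separate mean value points, each within [2 * |y - x|] of [t]; the
    Lipschitz bounds then give an error of [2 * |y - x| ^+ 2] in each component. The point [t] is
    left free because it will be the tag of a Riemann sum. *)
Lemma expi_taylor x y t : `|t - x| <= `|y - x| ->
  cabs (expi y - expi x - 'i%C * (y - x)%:C * expi t) <= 4 * `|y - x| ^+ 2.
Proof.
move=> tx; have ct c : `|c - x| <= `|y - x| -> `|t - c| <= 2 * `|y - x|.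
  move=> cx; rewrite -(subrK x t) -addrA (le_trans (ler_normD _ _))//.
  by rewrite mulr_natl mulr2n lerD// distrC.
have [c /ct c1 cE] := mvt_any_order (f := cos) x y (fun t => is_derive_cos t).
have [s /ct s1 sE] :=
  mvt_any_order (f := sin) (df := cos) x y (fun t => is_derive_sin t).
have -> : expi y - expi x - 'i%C * (y - x)%:C * expi t =
    ((sin t - sin c) * (y - x)) +i* (- ((cos t - cos s) * (y - x))).
  apply/eqP; rewrite eq_complex /= !(mul0r, mulr0, mul1r, add0r, subr0, sub0r, addr0).
  by rewrite cE sE; apply/andP; split; apply/eqP; ring.
rewrite (le_trans (cabs_le_ReIm _))//= normrN !normrM -mulrDl expr2 mulrA.
rewrite ler_wpM2r// (le_trans (lerD (sin_lipschitz _ _) (cos_lipschitz _ _)))//.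
have -> : 4 * `|y - x| = 2 * `|y - x| + 2 * `|y - x| by ring.
exact: lerD.
Qed.

(** Multiplied by [i k], each term of the Riemann sum is an increment of [expi (k t)] up to a
    quadratic error. The increments telescope to 0 over a full period, since [k] is an integer, and
    the errors add up to a multiple of the mesh. *)
Lemma is_riemann_integral_expi {V : normedModType R[i]} (k : int) (v : V) :
  k != 0 ->
  is_riemann_integral (fun t => expi (k%:~R * t) *: v) 0 (2 * pi) 0.
Proof.
move=> k0 e e0; pose K : R := `|k%:~R|.
have K0 : 0 < K by rewrite normr_gt0 intr_eq0.
have v0 : 0 < rnorm v + 1 by rewrite ltr_wpDl ?rnorm_ge0.
(* The errors total at most [2 pi * 4 K^2 * mesh]; after division by [K], the mesh [e / W] leaves
   [e / (rnorm v + 1)] for the scalar sum [S]. *)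
pose W := 8 * pi * K * (rnorm v + 1).
have W0 : 0 < W.
  by rewrite !mulr_gt0 ?pi_gt0// ltr_wpDl ?rnorm_ge0.
exists (e / W); first by rewrite divr_gt0.
move=> s xi ps ts; rewrite subr0 /riemann_sum.
under eq_bigr do rewrite scalerA.
rewrite -scaler_suml rnormZ; set S := \sum_(i < _) _.
have SE : 'i%C * (k%:~R : R)%:C * S = - \sum_(i < size s)
    (expi (k%:~R * s`_i) - expi (k%:~R * (0 :: s)`_i) -
     'i%C * (k%:~R * s`_i - k%:~R * (0 :: s)`_i)%:C * expi (k%:~R * xi i)).
  rewrite sumrB (sum_partition (fun t => expi (k%:~R * t)) ps) expi2pi.
  rewrite mulr0 expi0 subrr sub0r opprK mulr_sumr; apply: eq_bigr => i _.
  by rewrite -mulrBr rmorphM /= !mulrA.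
have Sle : K * cabs S <= 8 * pi * K ^+ 2 * (e / W).
  have -> : K * cabs S = cabs ('i%C * (k%:~R : R)%:C * S).
    by rewrite !cabsM cabsR cabs_i mul1r.
  rewrite SE cabsN (le_trans (@rnorm_sum _ R[i]^o _ _ _ _))//.
  have -> : 8 * pi * K ^+ 2 * (e / W) =
      \sum_(i < size s) (s`_i - (0 :: s)`_i) * (4 * K ^+ 2 * (e / W)).
    by rewrite -mulr_suml (sum_partition id ps) subr0; ring.
  apply: ler_sum => i _; have [di /andP[xi1 xi2]] := ts i (ltn_ord i).
  have D0 : 0 < s`_i - (0 :: s)`_i by rewrite subr_gt0 (partition_lt ps).
  rewrite (le_trans (expi_taylor _))//.
    rewrite -!mulrBr !normrM ler_wpM2l//.
    rewrite !ger0_norm ?subr_ge0//; last exact: le_trans xi2.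
    by rewrite lerD2r.
  rewrite -mulrBr normrM exprMn -/K (gtr0_norm D0).
  set D := _ - _ in di D0 *.
  have -> : 4 * (K ^+ 2 * D ^+ 2) = D * (4 * K ^+ 2 * D) by ring.
  by rewrite ler_pM2l// ler_wpM2l ?mulr_ge0 ?sqr_ge0// ltW.
have {}Sle : cabs S <= e / (rnorm v + 1).
  rewrite -(ler_pM2l K0) (le_trans Sle)// le_eqVlt; apply/orP; left; apply/eqP.
  rewrite /W; move: (pi_gt0 R); generalize (pi : R) => P P0.
  by field; apply/and3P; split; exact: lt0r_neq0.
rewrite (le_lt_trans (ler_wpM2r (rnorm_ge0 _) Sle))//.
by rewrite -mulrA gtr_pMr// ltr_pdivrMl// mulr1 ltrDl.
Qed.

End ExponentialIntegral.

(** * Fourier coefficients *)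

Section FourierCoefficients.
Context {R : realType} {A : completeNormedModType R[i]}.
Implicit Types (F G : R[i] -> A) (z : R[i]).

Let pi2_gt0 : 0 < 2 * pi :> R. Proof. by rewrite mulr_gt0 ?pi_gt0. Qed.

(** Relational form, which includes the existence of the integral; [fourier_coef] alone would take
    the default value 0 if the integral did not exist. *)
Definition is_fourier_coef F (n : int) (c : A) : Prop :=
  is_riemann_integral (fun t => expi (- (n%:~R * t)) *: F (expi t))
    0 (2 * pi) ((2 * pi)%:C *: c).

Definition has_fourier F := forall n, is_fourier_coef F n (fourier_coef F n).

Lemma is_fourier_coefE F n c : is_fourier_coef F n c -> fourier_coef F n = c.
Proof.
move=> H; rewrite /fourier_coef (riemann_integralE pi2_gt0 H) scalerA.
by rewrite -rmorphM /= mulVf ?scale1r// gt_eqF.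
Qed.

Lemma eq_fourier_coef F G : (forall z, circle z -> F z = G z) ->
  forall n, fourier_coef F n = fourier_coef G n.
Proof.
move=> FG n; rewrite /fourier_coef; congr (_ *: riemann_integral _ _ _).
by apply/funext => t; rewrite FG.
Qed.

Lemma eq_has_fourier F G : (forall z, circle z -> F z = G z) ->
  has_fourier F -> has_fourier G.
Proof.
move=> FG HF n; rewrite -(eq_fourier_coef FG).
by apply: eq_is_riemann_integral (HF n) => t; rewrite FG.
Qed.

Lemma is_fourier_coefD F G n c d :
  is_fourier_coef F n c -> is_fourier_coef G n d ->
  is_fourier_coef (fun z => F z + G z) n (c + d).
Proof.
move=> Fc Gd; rewrite /is_fourier_coef scalerDr.
apply: eq_is_riemann_integral (is_riemann_integralD Fc Gd) => t.
by rewrite scalerDr.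
Qed.

Lemma is_fourier_coefZ F n c (u : R[i]) :
  is_fourier_coef F n c -> is_fourier_coef (fun z => u *: F z) n (u *: c).
Proof.
move=> Fc; rewrite /is_fourier_coef scalerA -(mulrC u) -scalerA.
apply: eq_is_riemann_integral (is_riemann_integralZ u Fc) => t.
by rewrite !scalerA mulrC.
Qed.

Lemma is_fourier_coef_monomial (m : int) (v : A) n :
  is_fourier_coef (fun z => z ^ m *: v) n (if m == n then v else 0).
Proof.
have E t : expi (- (n%:~R * t)) *: (expi t ^ m *: v) =
    expi ((m - n)%:~R * t) *: v.
  by rewrite expiXz scalerA -expiD -mulNr -mulrDl addrC rmorphB.
have [->|mn] := eqVneq m n; rewrite /is_fourier_coef.
  rewrite -[X in X%:C](subr0 (2 * pi)).
  apply: eq_is_riemann_integral (is_riemann_integral_cst v _ _) => t.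
  by rewrite expiXz scalerA -expiD addNr expi0 scale1r.
have mn0 : m - n != 0 by rewrite subr_eq0.
rewrite /= scaler0.
apply: eq_is_riemann_integral (is_riemann_integral_expi v mn0) => t.
by rewrite E.
Qed.

Lemma has_fourierD F G : has_fourier F -> has_fourier G ->
  has_fourier (fun z => F z + G z).
Proof.
move=> HF HG n; have H := is_fourier_coefD (HF n) (HG n).
by rewrite (is_fourier_coefE H).
Qed.

Lemma has_fourierZ F (u : R[i]) : has_fourier F ->
  has_fourier (fun z => u *: F z).
Proof.
move=> HF n; have H := is_fourier_coefZ u (HF n).
by rewrite (is_fourier_coefE H).
Qed.

Lemma fourier_coefD F G n : has_fourier F -> has_fourier G ->
  fourier_coef (fun z => F z + G z) n = fourier_coef F n + fourier_coef G n.
Proof. by move=> HF HG; exact: is_fourier_coefE (is_fourier_coefD _ _). Qed.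

Lemma has_fourierB F G : has_fourier F -> has_fourier G ->
  has_fourier (fun z => F z - G z).
Proof.
move=> HF /(has_fourierZ (-1)) HG; apply: eq_has_fourier (has_fourierD HF HG).
by move=> z _; rewrite scaleN1r.
Qed.

Lemma fourier_coefB F G n : has_fourier F -> has_fourier G ->
  fourier_coef (fun z => F z - G z) n = fourier_coef F n - fourier_coef G n.
Proof.
move=> HF HG; apply: is_fourier_coefE.
have := is_fourier_coefD (HF n) (is_fourier_coefZ (-1) (HG n)).
by rewrite scaleN1r; apply: eq_is_riemann_integral => t; rewrite scaleN1r.
Qed.

Lemma fourier_coef_shift F (m n : int) :
  fourier_coef (fun z => z ^ m *: F z) n = fourier_coef F (n - m).
Proof.
rewrite /fourier_coef; congr (_ *: riemann_integral _ _ _); apply/funext => t.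
by rewrite scalerA expiXz -expiD -!mulNr -mulrDl rmorphB opprB addrC.
Qed.

Lemma fourier_coef_bound F (M : R) n : has_fourier F ->
  (forall z, circle z -> rnorm (F z) <= M) -> rnorm (fourier_coef F n) <= M.
Proof.
move=> HF FM; have := is_riemann_integral_bound pi2_gt0 (HF n) (M := M).
rewrite subr0 rnormZ cabsR gtr0_norm// ler_pM2l//; apply=> t.
by rewrite rnormZ_circle// FM.
Qed.

Lemma has_fourier_limit F :
  (forall e : R, 0 < e -> exists2 G, has_fourier G &
     forall z, circle z -> rnorm (F z - G z) <= e) ->
  has_fourier F.
Proof.
move=> H n.
have [e e0|I HI] := @is_riemann_integral_limit _ _
    (fun t => expi (- (n%:~R * t)) *: F (expi t)) _ _ pi2_gt0.
  have [G HG FG] := H _ e0.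
  exists (fun t => expi (- (n%:~R * t)) *: G (expi t)).
  exists ((2 * pi)%:C *: fourier_coef G n); split; first exact: HG.
  by move=> t; rewrite -scalerBr rnormZ_circle// FG.
have IE : I = (2 * pi)%:C *: ((2 * pi)^-1%:C *: I).
  by rewrite scalerA -rmorphM /= mulfV ?scale1r// gt_eqF.
have H' : is_fourier_coef F n ((2 * pi)^-1%:C *: I).
  by rewrite /is_fourier_coef -IE.
by rewrite (is_fourier_coefE H').
Qed.

End FourierCoefficients.

(** * Laurent polynomials *)

Section BanachAlgebra.
Context {R : realType} {A : unitalBanachAlgType R[i]}.
Implicit Types x y : A.

Lemma bmul0x x : bmul 0 x = 0.
Proof. by apply: (addrI (bmul 0 x)); rewrite -bmulDl !addr0. Qed.

Lemma bmulx0 x : bmul x 0 = 0.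
Proof. by apply: (addrI (bmul x 0)); rewrite -bmulDr !addr0. Qed.

Lemma bmulNx x y : bmul (- x) y = - bmul x y.
Proof. by apply: (addrI (bmul x y)); rewrite -bmulDl !subrr bmul0x. Qed.

Lemma bmulxN x y : bmul x (- y) = - bmul x y.
Proof. by apply: (addrI (bmul x y)); rewrite -bmulDr !subrr bmulx0. Qed.

Lemma bmulBl x y z : bmul (x - y) z = bmul x z - bmul y z.
Proof. by rewrite bmulDl bmulNx. Qed.

Lemma bmulBr x y z : bmul x (y - z) = bmul x y - bmul x z.
Proof. by rewrite bmulDr bmulxN. Qed.

Lemma bmul_suml I (r : seq I) (P : pred I) (F : I -> A) x :
  bmul (\sum_(i <- r | P i) F i) x = \sum_(i <- r | P i) bmul (F i) x.
Proof. exact: (big_morph _ (fun a b => bmulDl a b x) (bmul0x x)). Qed.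

Lemma bmul_sumr I (r : seq I) (P : pred I) (F : I -> A) x :
  bmul x (\sum_(i <- r | P i) F i) = \sum_(i <- r | P i) bmul x (F i).
Proof. exact: (big_morph _ (bmulDr x) (bmulx0 x)). Qed.

Lemma rnorm_bmul x y : rnorm (bmul x y) <= rnorm x * rnorm y.
Proof. by rewrite -lecR rmorphM /= !rnormE normr_bmul. Qed.

End BanachAlgebra.

Section IntegerRange.

Definition irange (N : nat) : seq int :=
  [seq k%:Z - N%:Z | k <- index_iota 0 N.*2.+1].

Lemma mem_irange N (n : int) : (n \in irange N) = (`|n|%N <= N)%N.
Proof.
apply/mapP/idP => [[k]|nN].
  by rewrite mem_index_iota => /andP[_ kN] ->; lia.
exists (absz (n + N%:Z)); first by rewrite mem_index_iota; lia.
by lia.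
Qed.

Lemma irange_uniq N : uniq (irange N).
Proof. by rewrite map_inj_uniq ?iota_uniq// => k l /addIr[]. Qed.

Lemma size_irange N : size (irange N) = N.*2.+1.
Proof. by rewrite size_map size_iota subn0. Qed.

Lemma irange_split i j : (i <= j)%N ->
  perm_eq (irange j) (irange i ++ [seq n <- irange j | (i < `|n|)%N]).
Proof.
move=> ij; rewrite uniq_perm ?irange_uniq// => [|n].
  rewrite cat_uniq irange_uniq filter_uniq ?irange_uniq// andbT.
  by apply/hasPn => n; rewrite mem_filter !mem_irange -ltnNge => /andP[].
rewrite mem_cat mem_filter !mem_irange; case: leqP => //=.
by move=> ni; rewrite (leq_trans ni).
Qed.

End IntegerRange.

Section LaurentPolynomials.
Context {R : realType} {A : unitalBanachAlgType R[i]}.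
Implicit Types (F G : R[i] -> A) (z : R[i]) (s t : seq (int * A)).

Lemma fourier_partial_sumE F z N :
  fourier_partial_sum F z N = \sum_(n <- irange N) z ^ n *: fourier_coef F n.
Proof.
by rewrite big_map big_mkord.
Qed.

(** Exponents may repeat in the list, so that sums are concatenations and products are lists of
    pairs. The function is constrained on the circle only. *)
Definition laurent (D : nat) F := exists2 s : seq (int * A),
  all (fun x => `|x.1|%N <= D)%N s &
  forall z, circle z -> F z = \sum_(x <- s) z ^ x.1 *: x.2.

Lemma eq_laurent D F G : (forall z, circle z -> F z = G z) ->
  laurent D F -> laurent D G.
Proof. by move=> FG [s sD Fs]; exists s => // z cz; rewrite -FG// Fs. Qed.

Lemma leq_laurent D E F : (D <= E)%N -> laurent D F -> laurent E F.
Proof.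
move=> DE [s sD Fs]; exists s => //; apply: sub_all sD => x xD.
exact: leq_trans DE.
Qed.

Lemma laurent_monomial (n : int) (v : A) : laurent `|n| (fun z => z ^ n *: v).
Proof.
by exists [:: (n, v)] => [|z _]; rewrite /= ?leqnn// big_seq1.
Qed.

Lemma laurent_cst D (v : A) : laurent D (fun=> v).
Proof.
apply: (leq_laurent (leq0n D)); apply: eq_laurent (laurent_monomial 0 v) => z _.
by rewrite scale1r.
Qed.

Lemma laurentD D F G : laurent D F -> laurent D G ->
  laurent D (fun z => F z + G z).
Proof.
move=> [s sD Fs] [t tD Gt]; exists (s ++ t); first by rewrite all_cat sD.
by move=> z cz; rewrite big_cat Fs// Gt.
Qed.

Lemma laurentM D E F G : laurent D F -> laurent E G ->
  laurent (D + E) (fun z => bmul (F z) (G z)).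
Proof.
move=> [s sD Fs] [t tE Gt].
exists [seq (x.1 + y.1, bmul x.2 y.2) | x <- s, y <- t].
  apply/allP => _ /allpairsP[[x y] [/= xs yt ->]] /=.
  have := allP sD _ xs; have := allP tE _ yt => /=; lia.
move=> z cz; rewrite Fs// Gt// big_allpairs_dep bmul_suml.
apply: eq_bigr => x _; rewrite bmul_sumr; apply: eq_bigr => y _ /=.
by rewrite -bscalerAl -bscalerAr scalerA -expfzDr ?circle_neq0.
Qed.

Lemma laurentN D F : laurent D F -> laurent D (fun z => - F z).
Proof.
move=> LF; have := laurentM (laurent_cst 0 (- bone)) LF; rewrite add0n.
by apply: eq_laurent => z _; rewrite bmulNx bmul1x.
Qed.

Lemma laurentB D F G : laurent D F -> laurent D G ->
  laurent D (fun z => F z - G z).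
Proof. by move=> LF LG; apply: laurentD LF (laurentN LG). Qed.

Lemma laurent_sum (I : eqType) (r : seq I) D (F : I -> R[i] -> A) :
  (forall i, i \in r -> laurent D (F i)) ->
  laurent D (fun z => \sum_(i <- r) F i z).
Proof.
elim: r => [_|i r IH H].
  by apply: eq_laurent (laurent_cst D 0) => z _; rewrite big_nil.
have := laurentD (H i (mem_head _ _)) (IH _).
move=> L; apply: eq_laurent (L _) => [z _|j jr]; first by rewrite big_cons.
by apply: H; rewrite inE jr orbT.
Qed.

Lemma laurent_fourier_coef F s n :
  (forall z, circle z -> F z = \sum_(x <- s) z ^ x.1 *: x.2) ->
  is_fourier_coef F n (\sum_(x <- s | x.1 == n) x.2).
Proof.
have cst0 k : is_fourier_coef (fun=> 0 : A) k 0.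
  have := is_fourier_coefZ 0 (is_fourier_coef_monomial 0 (0 : A) k).
  rewrite scale0r; apply: eq_is_riemann_integral => t.
  by rewrite scaler0 scale0r.
elim: s F => [|x s IH] F Fs.
  rewrite big_nil; apply: eq_is_riemann_integral (cst0 n) => t.
  by rewrite Fs ?big_nil//; exact: circle_expi.
have := is_fourier_coefD (is_fourier_coef_monomial x.1 x.2 n)
  (IH (fun z => \sum_(x <- s) z ^ x.1 *: x.2) (fun z _ => erefl)).
rewrite big_cons; set a := (X in is_fourier_coef _ _ X -> _).
set b := (X in _ -> is_fourier_coef _ _ X).
have -> : b = a by rewrite /a /b; case: ifP => //; rewrite add0r.
apply: eq_is_riemann_integral => t.
by rewrite Fs ?big_cons//; exact: circle_expi.
Qed.

Lemma laurent_has_fourier D F : laurent D F -> has_fourier F.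
Proof.
move=> [s _ Fs] n; have H := laurent_fourier_coef n Fs.
by rewrite (is_fourier_coefE H).
Qed.

Lemma laurent_coef_eq0 D F n : laurent D F -> (D < `|n|)%N ->
  fourier_coef F n = 0.
Proof.
move=> [s sD Fs] Dn; rewrite (is_fourier_coefE (laurent_fourier_coef n Fs)).
rewrite big_seq_cond big1// => x /andP[/(allP sD) /= + /eqP xn].
by rewrite xn leqNgt Dn.
Qed.

Lemma laurent_expansion D N F z : laurent D F -> (D <= N)%N -> circle z ->
  \sum_(n <- irange N) z ^ n *: fourier_coef F n = F z.
Proof.
move=> [s sD Fs] DN cz; rewrite Fs//.
under eq_bigr do
  rewrite (is_fourier_coefE (laurent_fourier_coef _ Fs)) scaler_sumr big_mkcond.
rewrite exchange_big /= big_seq [RHS]big_seq; apply: eq_bigr => x xs.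
rewrite (bigD1_seq x.1) ?irange_uniq//=; last first.
  by rewrite mem_irange (leq_trans _ DN)//; exact: (allP sD).
by rewrite eqxx big1 ?addr0// => n; rewrite eq_sym => /negbTE ->.
Qed.

(** Natural powers go by induction; negative ones reduce to them because inversion is an isometry of
    the circle. *)
Lemma intX_lipschitz (n : int) z1 z2 : circle z1 -> circle z2 ->
  cabs (z1 ^ n - z2 ^ n) <= `|n|%N%:R * cabs (z1 - z2).
Proof.
move=> c1 c2; have H k (u v : R[i]) : circle u -> circle v ->
    cabs (u ^+ k - v ^+ k) <= k%:R * cabs (u - v).
  move=> cu cv; elim: k => [|k IH]; first by rewrite !expr0 subrr cabs0 mul0r.
  have -> : u ^+ k.+1 - v ^+ k.+1 = u * (u ^+ k - v ^+ k) + (u - v) * v ^+ k.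
    by rewrite !exprS; ring.
  rewrite (le_trans (cabsD _ _))// -natr1 [leRHS]mulrDl mul1r !cabsM.
  have /circleP -> := circleX k cv; have /circleP -> := cu.
  by rewrite mul1r mulr1 lerD2r.
case: n => n; first exact: H.
rewrite /exprz /= -!exprVn.
rewrite (le_trans (H _ _ _ (circleV c1) (circleV c2)))// ler_wpM2l//.
have -> : z1^-1 - z2^-1 = - (z1^-1 * z2^-1 * (z1 - z2)).
  by field; rewrite !circle_neq0.
rewrite cabsN !cabsM; have /circleP -> := circleV c1.
by have /circleP -> := circleV c2; rewrite !mul1r.
Qed.

Lemma laurent_lipschitz D F : laurent D F -> exists2 L : R, 0 < L &
  forall z1 z2, circle z1 -> circle z2 ->
    rnorm (F z1 - F z2) <= L * cabs (z1 - z2).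
Proof.
move=> [s _ Fs].
exists (1 + \sum_(x <- s) `|x.1|%N%:R * rnorm x.2).
  by rewrite ltr_pwDl// sumr_ge0// => x _; rewrite mulr_ge0 ?rnorm_ge0.
move=> z1 z2 c1 c2; rewrite !Fs// -sumrB (le_trans (rnorm_sum _ _ _))//.
rewrite mulrDl mul1r ler_wpDl ?cabs_ge0// mulr_suml ler_sum// => x _.
rewrite -scalerBl rnormZ mulrAC ler_wpM2r ?rnorm_ge0//.
exact: intX_lipschitz.
Qed.

(** The sup-norm closure of the Laurent polynomials. Integrability, boundedness and uniform
    continuity on the circle are all inherited from the approximants. *)
Definition laurent_limit F := forall e : R, 0 < e ->
  exists D G, laurent D G /\ forall z, circle z -> rnorm (F z - G z) <= e.

Lemma laurent_limit_has_fourier F : laurent_limit F -> has_fourier F.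
Proof.
move=> H; apply: has_fourier_limit => e /H[D [G [LG FG]]].
by exists G => //; exact: laurent_has_fourier LG.
Qed.

Lemma laurent_limit_unif_continuous F : laurent_limit F ->
  forall e : R, 0 < e -> exists2 d : R, 0 < d &
  forall z1 z2, circle z1 -> circle z2 -> cabs (z1 - z2) < d ->
    rnorm (F z1 - F z2) < e.
Proof.
move=> H e e0; have [|D [G [LG FG]]] := H (e / 3); first by rewrite divr_gt0.
have [L L0 GL] := laurent_lipschitz LG.
exists (e / 3 / L); first by rewrite !divr_gt0.
move=> z1 z2 c1 c2; rewrite ltr_pdivlMr// mulrC => dz.
have -> : e = e / 3 + (e / 3 + e / 3) by field.
rewrite (le_lt_trans (rnorm_dist (G z1) _ _))// ler_ltD ?FG//.
rewrite (le_lt_trans (rnorm_dist (G z2) _ _))// ltr_leD//.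
  exact: le_lt_trans (GL _ _ c1 c2) dz.
by rewrite rnormB FG.
Qed.

Lemma laurent_bounded D F : laurent D F ->
  exists2 M : R, 0 < M & forall z, circle z -> rnorm (F z) <= M.
Proof.
move=> [s _ Fs]; exists (1 + \sum_(x <- s) rnorm x.2).
  by rewrite ltr_pwDl// sumr_ge0// => x _; exact: rnorm_ge0.
move=> z cz; rewrite Fs// (le_trans (rnorm_sum _ _ _))// ler_wpDl//.
by apply: ler_sum => x _; rewrite rnormZ_circle//; exact: circleX.
Qed.

Lemma laurent_limit_bounded F : laurent_limit F ->
  exists2 M : R, 0 < M & forall z, circle z -> rnorm (F z) <= M.
Proof.
move=> /(_ 1 ltr01)[D [G [/laurent_bounded[M M0 GM] FG]]].
exists (1 + M) => [|z cz]; first by rewrite addr_gt0.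
by rewrite -[F z](subrK (G z)) (le_trans (rnormD _ _))// lerD ?FG ?GM.
Qed.

Lemma laurent_limit_continuous F : laurent_limit F -> continuous_on_circle F.
Proof.
move=> /laurent_limit_unif_continuous H; rewrite /continuous_on_circle.
apply/(@subspace_continuousP _ _ _ (F : R[i]^o -> A)) => z cz.
apply/cvgrPdist_lt => _ /gt0_complex[e e0 ->].
have [d d0 Hd] := H _ e0.
near=> t.
have ct : circle t by near: t; exact: withinT.
rewrite -rnormE ltcR Hd// -ltcR cabsE.
near: t.
apply: cvg_within.
have : 0 < d%:C by rewrite ltcR.
move=> dd0.
by apply/(@nbhs_normP _ R[i]^o); exists d%:C.
Unshelve. all: by end_near. Qed.

End LaurentPolynomials.

(** * Fejer interpolation *)

Section RootsOfUnity.
Context {R : realType}.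

Lemma expi_surj (z : R[i]) : circle z ->
  exists2 t : R, t \in `[- pi, pi] & expi t = z.
Proof.
case: z => a b; rewrite /circle /= normc_def /= => -[ab1].
have {}ab1 : a ^+ 2 + b ^+ 2 = 1.
  rewrite -[LHS]sqr_sqrtr ?addr_ge0 ?sqr_ge0//.
  by rewrite ab1 expr1n.
have a1 : -1 <= a <= 1.
  rewrite -ler_norml -(@ler_pXn2r _ 2) ?nnegrE// expr1n real_normK ?num_real//.
  by rewrite -ab1 lerDl sqr_ge0.
have ca : cos (acos a) = a by rewrite acosK.
have sa : sin (acos a) = `|b|.
  by rewrite sin_acos// -sqrtr_sqr -ab1 addrAC subrr add0r.
have [p0 p1] : 0 <= acos a /\ acos a <= pi by rewrite acos_ge0 ?acos_lepi.
have [b0|b0] := leP 0 b.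
  exists (acos a); last by rewrite /expi ca sa ger0_norm.
  by rewrite in_itv /= p1 andbT (le_trans _ p0)// oppr_le0 pi_ge0.
exists (- acos a); last by rewrite /expi cosN sinN ca sa ltr0_norm// opprK.
by rewrite in_itv /= lerN2 p1 (le_trans _ (pi_ge0 R))// oppr_le0.
Qed.

(** Here [cos t = 1 - 2 sin^2 (t / 2)] and [sin (t / 2) > 0]. *)
Lemma expi_neq1 (t : R) : 0 < t -> t < 2 * pi -> expi t != 1.
Proof.
move=> t0 t2; apply/negP => /eqP[ct _].
have s0 : 0 < sin (t / 2).
  by rewrite sin_gt0_pi// ?divr_gt0// ltr_pdivrMr// mulrC.
move: ct; rewrite [t]splitr cosD -!expr2 cos2sin2 => /eqP.
rewrite -subr_eq0; suff -> : 1 - sin (t / 2) ^+ 2 - sin (t / 2) ^+ 2 - 1 =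
  - (2 * sin (t / 2) ^+ 2) by rewrite oppr_eq0 gt_eqF// mulr_gt0// exprn_gt0.
by ring.
Qed.

Lemma prim_root_exists (M : nat) : (0 < M)%N ->
  exists2 zeta : R[i], circle zeta & M.-primitive_root zeta.
Proof.
move=> M0; have MR : 0 < M%:R :> R by rewrite ltr0n.
exists (expi (2 * pi / M%:R)) => //.
have E k : expi (2 * pi / M%:R : R) ^+ k = expi (k%:R * (2 * pi / M%:R)).
  exact: (expiXz k).
apply/andP; split => //; apply/forallP => -[i iM] /=.
rewrite unity_rootE E; apply/eqP; have [->|neq] := eqVneq i.+1 M.
  have -> : M%:R * (2 * pi / M%:R) = 1%:~R * (2 * pi) :> R.
    by rewrite mulrCA mulfV ?lt0r_neq0// mulr1 mul1r.
  by rewrite expi2pi eqxx.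
apply/negbTE/expi_neq1; first by rewrite mulr_gt0 ?divr_gt0 ?mulr_gt0 ?pi_gt0.
rewrite mulrCA gtr_pMr ?mulr_gt0 ?pi_gt0// ltr_pdivrMr// mul1r ltr_nat.
by rewrite ltn_neqAle neq.
Qed.

End RootsOfUnity.

Section FejerKernel.
Context {R : realType}.
Variables (M : nat) (M_gt0 : (0 < M)%N).
Implicit Types x z : R[i].

(* On the circle this is |sum_(k < M) x^k|^2 / M^2. *)
Definition fejer x : R[i] :=
  M%:R^-1 ^+ 2 * \sum_(k < M) \sum_(l < M) x ^ (k%:Z - l%:Z).

Lemma fejerE x : circle x ->
  fejer x = M%:R^-1 ^+ 2 * ((\sum_(k < M) x ^+ k) * (\sum_(l < M) x^-1 ^+ l)).
Proof.
move=> cx; rewrite /fejer mulr_suml; congr (_ * _); apply: eq_bigr => k _.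
rewrite mulr_sumr; apply: eq_bigr => l _.
by rewrite expfzDr ?circle_neq0// exprVn exprnN.
Qed.

Lemma fejer_ge0 x : circle x -> 0 <= fejer x.
Proof.
move=> cx; rewrite fejerE// mulr_ge0 ?exprn_ge0 ?invr_ge0 ?ler0n//.
suff -> : \sum_(l < M) x^-1 ^+ l = Num.conj (\sum_(k < M) x ^+ k).
  exact: mul_conjC_ge0.
rewrite rmorph_sum; apply: eq_bigr => k _; rewrite rmorphXn /=; congr (_ ^+ _).
by rewrite invC_norm cx expr1n invr1 mul1r.
Qed.

(** The translates of the kernel form a partition of unity. After exchanging sums, a pair [k != l]
    contributes the sum of the first [M] powers of [zeta ^ (l - k)], a nontrivial [M]-th root of
    unity, which vanishes; the [M] diagonal pairs contribute [M] each. *)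
Lemma sum_fejer zeta z : circle zeta -> M.-primitive_root zeta -> circle z ->
  \sum_(j < M) fejer (z / zeta ^+ j) = 1.
Proof.
move=> czeta pzeta cz; rewrite /fejer -mulr_sumr exchange_big /=.
have MN : M%:R != 0 :> R[i] by rewrite pnatr_eq0 -lt0n.
rewrite (eq_bigr (fun=> M%:R)) => [|k _].
  by rewrite sumr_const card_ord -(mulr_natr M%:R) exprVn -expr2 mulVf ?expf_neq0.
rewrite exchange_big /= (bigD1 k)//= [X in _ + X]big1 ?addr0 => [|l lk].
  rewrite (eq_bigr (fun=> 1)) => [|j _]; last by rewrite subrr.
  by rewrite sumr_const card_ord.
pose y := zeta ^ (l%:Z - k%:Z).
have yM : y ^+ M = 1.
  by rewrite /y -[_ ^+ M]/(_ ^ M) exprzAC -[_ ^ M]/(_ ^+ M) (prim_expr_order pzeta) exp1rz.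
have y1 : y - 1 != 0.
  rewrite subr_eq0 /y expfzDr ?circle_neq0// -invr_expz.
  rewrite -(inj_eq (mulIf (circle_neq0 (circleX k czeta)))) mulfVK ?circle_neq0//; last exact: circleX.
  rewrite mul1r (eq_prim_root_expr pzeta) !modn_small//.
rewrite (eq_bigr (fun j : 'I_M => z ^ (k%:Z - l%:Z) * y ^+ j)) => [|j _].
  rewrite -mulr_sumr; apply/eqP; rewrite mulf_eq0; apply/orP; right.
  by rewrite -(inj_eq (mulfI y1)) mulr0 -subrX1 yM subrr.
rewrite expfzMl; congr (_ * _); rewrite -[zeta ^+ j]/(zeta ^ j%:Z) invr_expz.
rewrite -[RHS]/(y ^ j%:Z) /y !exprz_exp; congr (_ ^ _); ring.
Qed.

(** Both factors in [fejerE] are geometric sums [(y ^+ M - 1) / (y - 1)], at most [2 / d], since [x]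
    and [x^-1] are equally far from 1. *)
Lemma fejer_bound x (d : R) : circle x -> 0 < d -> d <= cabs (x - 1) ->
  cabs (fejer x) <= 4 / (M%:R * d) ^+ 2.
Proof.
move=> cx d0 dx.
have geo y : circle y -> d <= cabs (y - 1) -> cabs (\sum_(k < M) y ^+ k) <= 2 / d.
  move=> cy dy; have y0 : 0 < cabs (y - 1) := lt_le_trans d0 dy.
  have H : cabs (y - 1) * cabs (\sum_(k < M) y ^+ k) <= 2.
    rewrite -cabsM -subrX1 (le_trans (cabsD _ _))// cabsN cabs1.
    by have /circleP -> := circleX M cy.
  rewrite ler_pdivlMr// mulrC (le_trans _ H)// ler_wpM2r// cabs_ge0//.
rewrite fejerE// cabsM.
have -> : cabs (M%:R^-1 ^+ 2) = (M%:R^-1) ^+ 2 :> R.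
  by rewrite expr2 cabsM -expr2 cabsV -(rmorph_nat (real_complex R)) cabsR normr_nat.
rewrite cabsM exprMn.
have -> : 4 / (M%:R ^+ 2 * d ^+ 2) = M%:R^-1 ^+ 2 * ((2 / d) * (2 / d)) :> R.
  by field; rewrite lt0r_neq0//= pnatr_eq0 -lt0n.
rewrite ler_wpM2l ?exprn_ge0// ler_pM ?cabs_ge0 ?geo//; first exact: circleV.
have -> : x^-1 - 1 = - (x^-1 * (x - 1)) by field; rewrite circle_neq0.
by rewrite cabsN cabsM; have /circleP -> := circleV cx; rewrite mul1r.
Qed.

End FejerKernel.

(** * Gluing pointwise left inverses into a Laurent polynomial *)

Section ApproximateInverse.
Context {R : realType} {A : unitalBanachAlgType R[i]}.
Variable f : R[i] -> A.
Hypothesis f_lim : laurent_limit f.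
Hypothesis f_inv : forall z, circle z -> exists c, bmul c (f z) = bone.

(** A left inverse at one point is still an approximate left inverse nearby, by uniform continuity
    of [f]; compactness of [[- pi, pi]] makes the norms bounded. *)
Lemma uniform_left_inverse : exists2 C : R, 0 < C & forall z, circle z ->
  exists c, rnorm c <= C /\ rnorm (bone - bmul c (f z)) <= 1 / 4.
Proof.
pose P (C t : R) :=
  exists c : A, rnorm c <= C /\ rnorm (bone - bmul c (f (expi t))) <= 1 / 4.
have : \forall C \near +oo, `[- pi, pi] `<=` P C.
  have cpt : compact `[- pi, pi : R]%classic by exact: segment_compact.
  (* Near-covering form of compactness: it suffices that around each [x] the predicate [P C t] holds
     for [t] near [x] and all large [C]. *)
  apply: (compact_near_coveringP _).1 cpt _ _ _ _ _ => x _.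
  have [c cf] := f_inv (circle_expi x).
  have c1 : 0 < rnorm c + 1 by rewrite ltr_wpDl ?rnorm_ge0.
  have [|d d0 Hd] := laurent_limit_unif_continuous f_lim (e := 1 / 4 / (rnorm c + 1)).
    by rewrite !divr_gt0.
  exists ([set t | `|x - t| < 2^-1 * d], [set C | rnorm c <= C]); last first.
    move=> [t C] [/= xt cC]; exists c; split => //.
    rewrite -cf -bmulBr (le_trans (rnorm_bmul _ _))//.
    have : rnorm (f (expi x) - f (expi t)) < 1 / 4 / (rnorm c + 1).
      apply: Hd => //; rewrite (le_lt_trans (expi_lipschitz _ _))//.
      by rewrite -ltr_pdivlMl.
    rewrite ltr_pdivlMr// mulrC => /ltW; apply: le_trans.
    by rewrite ler_wpM2r ?rnorm_ge0// lerDl.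
  split; last exact: nbhs_pinfty_ge (num_real _).
  by apply/nbhs_normP; exists (2^-1 * d) => //=; rewrite mulr_gt0 ?invr_gt0.
move=> [C0 [_ HC]]; exists (Num.max 0 C0 + 1) => [|z cz].
  by rewrite ltr_wpDl// le_max lexx.
have [t tpi <-] := expi_surj cz; apply: HC => //.
by rewrite ltr_pwDr// le_max lexx orbT.
Qed.

(** The interpolant is [q = sum_j phi_j c_j], with [c_j] an approximate left inverse at the root
    [zeta ^+ j]. Since the [phi_j] sum to 1, [1 - q f] is the average of the [1 - c_j f]. Roots
    closer than [d] to [z] contribute at most [1 / 4 + 1 / 4] in total, and the far ones at most
    [1 / 4] by decay of the kernel. *)
Lemma approximate_left_inverse : exists D q, laurent D q /\
  forall z, circle z -> rnorm (bone - bmul (q z) (f z)) <= 3 / 4.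
Proof.
have [C C0 HC] := uniform_left_inverse.
have [F F0 HF] := laurent_limit_bounded f_lim.
have [|d d0 Hd] := laurent_limit_unif_continuous f_lim (e := 1 / 4 / C).
  by rewrite !divr_gt0.
pose E := rnorm (bone : A) + C * F.
have E0 : 0 <= E by rewrite addr_ge0 ?rnorm_ge0// mulr_ge0 ?ltW.
(* [E] bounds every [1 - c_j f]. The far roots contribute at most
   [M * 4 / (M d)^2 * E = 4 E / (M d^2)], which is at most [1 / 4] for this [M]. *)
pose M := (Num.bound (16 * E / d ^+ 2)).+1.
have M0 : 0 < M%:R :> R by rewrite ltr0n.
have ME : 16 * E / d ^+ 2 <= M%:R.
  rewrite (le_trans (ltW (archi_boundP _)))// ?ler_nat//.
  by rewrite !mulr_ge0// invr_ge0 sqr_ge0.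
have [zeta czeta pzeta] := @prim_root_exists R M isT.
have cj (j : nat) : circle (zeta ^+ j) := circleX j czeta.
have /choice[c cP] : forall j, exists c, rnorm c <= C /\
    rnorm (bone - bmul c (f (zeta ^+ j))) <= 1 / 4.
  by move=> j; apply: HC.
pose phi (j : nat) z := fejer M (z / zeta ^+ j).
exists M, (fun z => \sum_(j < M) phi j z *: c j); split.
  apply: laurent_sum => j _.
  (* The expanded kernel, whose exponents [k - l] have absolute value below [M]. *)
  pose g z := \sum_(k < M) \sum_(l < M) z ^ (k%:Z - l%:Z) *:
    ((M%:R^-1 ^+ 2 * (zeta ^+ j)^-1 ^ (k%:Z - l%:Z)) *: c j).
  apply: (@eq_laurent _ _ _ g) => [z cz|].
    rewrite /g /phi /fejer mulr_sumr scaler_suml; apply: eq_bigr => k _.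
    rewrite mulr_sumr scaler_suml; apply: eq_bigr => l _.
    by rewrite scalerA expfzMl; congr (_ *: _); ring.
  apply: laurent_sum => k _; apply: laurent_sum => l _.
  apply: leq_laurent (laurent_monomial _ _).
  have := ltn_ord k; have := ltn_ord l; lia.
move=> z cz.
have phi1 : \sum_(j < M) phi j z = 1 by exact: sum_fejer.
have phi_ge0 j : 0 <= phi j z.
  by apply: fejer_ge0 => //; apply: circleM => //; exact: circleV.
have aphi1 : \sum_(j < M) cabs (phi j z) = 1.
  apply: complexI; rewrite rmorph_sum rmorph1 -phi1; apply: eq_bigr => j _ /=.
  by rewrite cabsE ger0_norm.
have -> : bone - bmul (\sum_(j < M) phi j z *: c j) (f z) =
    \sum_(j < M) phi j z *: (bone - bmul (c j) (f z)).
  under [RHS]eq_bigr do rewrite scalerBr.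
  rewrite sumrB -scaler_suml phi1 scale1r bmul_suml; congr (_ - _).
  by apply: eq_bigr => j _; rewrite bscalerAl.
rewrite (le_trans (rnorm_sum _ _ _))//.
have bnd (j : 'I_M) : rnorm (phi j z *: (bone - bmul (c j) (f z))) <=
    cabs (phi j z) * (1 / 2) + 4 / (M%:R * d) ^+ 2 * E.
  have [cC c14] := cP j; rewrite rnormZ.
  have [zd|dz] := ltP (cabs (z - zeta ^+ j)) d.
    rewrite ler_wpDr ?mulr_ge0 ?invr_ge0 ?sqr_ge0// ler_wpM2l ?cabs_ge0//.
    rewrite (le_trans (rnorm_dist (bmul (c j) (f (zeta ^+ j))) _ _))//.
    have -> : 1 / 2 = 1 / 4 + 1 / 4 :> R by field.
    rewrite lerD// -bmulBr (le_trans (rnorm_bmul _ _))//.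
    have := Hd _ _ cz (cj j) zd; rewrite rnormB ltr_pdivlMr// mulrC => /ltW.
    by apply: le_trans; rewrite ler_wpM2r ?rnorm_ge0.
  rewrite ler_wpDl ?mulr_ge0 ?cabs_ge0// ler_pM ?cabs_ge0 ?rnorm_ge0//.
    apply: fejer_bound => //; first by apply: circleM => //; exact: circleV.
    rewrite -[leRHS]mulr1; have /circleP <- := cj j; rewrite -cabsM mulrBl.
    by rewrite divfK ?circle_neq0// mul1r.
  rewrite (le_trans (rnormD _ _))// lerD2l rnormN (le_trans (rnorm_bmul _ _))//.
  by rewrite ler_pM ?rnorm_ge0// HF.
rewrite (le_trans (ler_sum _ (fun j _ => bnd j)))// big_split /= -mulr_suml aphi1.
rewrite sumr_const card_ord -[X in _ + X]mulr_natl mul1r.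
have -> : M%:R * (4 / (M%:R * d) ^+ 2 * E) = 16 * E / d ^+ 2 / M%:R / 4.
  by field; rewrite !lt0r_neq0.
have : 16 * E / d ^+ 2 / M%:R <= 1 by rewrite ler_pdivrMr// mul1r.
by move=> ?; lra.
Qed.

End ApproximateInverse.

(** * Weighted p-th power sums *)

Section PowerNorm.
Context {R : realType} {A : unitalBanachAlgType R[i]}.
Variables (p : R) (p_gt0 : 0 < p) (p_le1 : p <= 1).
Implicit Types x y : A.

Lemma powRD_le (a b : R) : 0 <= a -> 0 <= b -> (a + b) `^ p <= a `^ p + b `^ p.
Proof.
move=> a0 b0; have [ab0|] := eqVneq (a + b) 0.
  by rewrite ab0 powR0 ?gt_eqF// addr_ge0 ?powR_ge0.
move=> abn0; have ab : 0 < a + b by rewrite lt0r abn0 addr_ge0.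
have H (c : R) : 0 <= c -> c <= a + b -> c / (a + b) * (a + b) `^ p <= c `^ p.
  move=> c0 cab; have [->|cn0] := eqVneq c 0; first by rewrite !mul0r powR_ge0.
  have {1}-> : c `^ p = (c / (a + b)) `^ p * (a + b) `^ p.
    by rewrite -powRM ?divfK ?divr_ge0// ltW.
  rewrite ler_wpM2r ?powR_ge0//.
  have c_gt0 : 0 < c by rewrite lt0r cn0.
  by apply: ger1_powR => //; rewrite divr_gt0//= ler_pdivrMr// mul1r.
rewrite (le_trans _ (lerD (H a a0 _) (H b b0 _))) ?lerDl ?lerDr//.
by rewrite -mulrDl -mulrDl mulfV// mul1r.
Qed.

Definition pn x : R := rnorm x `^ p.

Lemma pn_ge0 x : 0 <= pn x. Proof. exact: powR_ge0. Qed.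

Lemma pn0 : pn 0 = 0.
Proof. by rewrite /pn rnorm0 powR0// gt_eqF. Qed.

Lemma pnN x : pn (- x) = pn x. Proof. by rewrite /pn rnormN. Qed.

Lemma pnB x y : pn (x - y) = pn (y - x). Proof. by rewrite /pn rnormB. Qed.

Lemma pnD x y : pn (x + y) <= pn x + pn y.
Proof.
rewrite (le_trans _ (powRD_le _ _)) ?rnorm_ge0//.
by rewrite ge0_ler_powR ?nnegrE ?addr_ge0 ?rnorm_ge0 ?rnormD// ltW.
Qed.

Lemma pn_dist y x z : pn (x - z) <= pn (x - y) + pn (y - z).
Proof. by rewrite (le_trans _ (pnD _ _))// addrA subrK. Qed.

Lemma pnM x y : pn (bmul x y) <= pn x * pn y.
Proof.
rewrite -powRM ?rnorm_ge0//.
by rewrite ge0_ler_powR ?nnegrE ?mulr_ge0 ?rnorm_ge0 ?rnorm_bmul// ltW.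
Qed.

Lemma pnZ_circle z x : circle z -> pn (z *: x) = pn x.
Proof. by move=> cz; rewrite /pn rnormZ_circle. Qed.

Lemma pn_sum I (r : seq I) (P : pred I) (F : I -> A) :
  pn (\sum_(i <- r | P i) F i) <= \sum_(i <- r | P i) pn (F i).
Proof.
elim/big_rec2: _ => [|i a b _ ba]; first by rewrite pn0.
by rewrite (le_trans (pnD _ _))// lerD2l.
Qed.

Lemma pn_le x (e : R) : 0 <= e -> (pn x <= e `^ p) = (rnorm x <= e).
Proof.
move=> e0; apply/idP/idP => [|xe]; last first.
  by rewrite ge0_ler_powR ?nnegrE ?rnorm_ge0// ltW.
apply: contraTT; rewrite -!ltNge => ex.
by rewrite gt0_ltr_powR ?nnegrE ?rnorm_ge0.
Qed.

Lemma pn_leV x (e : R) : 0 <= e -> (pn x <= e) = (rnorm x <= e `^ p^-1).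
Proof.
move=> e0; rewrite -pn_le ?powR_ge0// -powRrM mulVf ?gt_eqF// powRr1//.
Qed.

Section WeightedSums.
Variables (nu : int -> R) (nu_weight : weight nu).

Let nu_ge0 n : 0 <= nu n.
Proof. by rewrite (le_trans ler01)//; case: nu_weight. Qed.

Lemma weight_powR_ge1 n : 1 <= nu n `^ p.
Proof.
rewrite -[leLHS](powRr0 (nu n)) ler_powR//; last exact: ltW.
by case: nu_weight.
Qed.

(** Bounds all finite partial sums, which avoids extended reals; [pboundP] links it to [esum]. *)
Definition pbound (c : int -> A) (C : R) := forall S : seq int, uniq S ->
  \sum_(n <- S) pn (c n) * nu n `^ p <= C.

Lemma eq_pbound c c' C : c =1 c' -> pbound c C -> pbound c' C.
Proof. by move=> /funext ->. Qed.

Lemma le_pbound c C C' : C <= C' -> pbound c C -> pbound c C'.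
Proof. by move=> CC' H S uS; rewrite (le_trans (H S uS)). Qed.

Lemma pboundD c d C D : pbound c C -> pbound d D ->
  pbound (fun n => c n + d n) (C + D).
Proof.
move=> Hc Hd S uS; rewrite (le_trans _ (lerD (Hc S uS) (Hd S uS)))//.
rewrite -big_split ler_sum// => n _ /=.
by rewrite -mulrDl ler_wpM2r ?powR_ge0// pnD.
Qed.

Lemma pbound_shift c C m : pbound c C ->
  pbound (fun n => c (n - m)) (nu m `^ p * C).
Proof.
move=> Hc S uS; have uS' : uniq [seq n - m | n <- S].
  by rewrite map_inj_uniq// => x y /addIr.
rewrite (le_trans _ (ler_wpM2l (powR_ge0 _ _) (Hc _ uS')))// big_map.
rewrite mulr_sumr ler_sum// => n _; rewrite mulrCA ler_wpM2l ?pn_ge0//.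
rewrite -powRM// ge0_ler_powR ?nnegrE ?mulr_ge0//; first exact: ltW.
by have [_ H] := nu_weight; rewrite -{1}(subrK m n) addrC H.
Qed.

Lemma pbound_sum_pn c C S : pbound c C -> uniq S -> \sum_(n <- S) pn (c n) <= C.
Proof.
move=> Hc uS; rewrite (le_trans _ (Hc S uS))// ler_sum// => n _.
by rewrite ler_peMr ?pn_ge0 ?weight_powR_ge1.
Qed.

(** A closedness property: on a finite [S] the weights have a finite total, so uniform closeness of
    coefficients is enough. *)
Lemma pbound_limit c C :
  (forall e : R, 0 < e -> exists2 d, pbound d C & forall n, pn (c n - d n) <= e) ->
  pbound c C.
Proof.
move=> H S uS; apply/ler_addgt0Pr => e e0.
pose W := 1 + \sum_(n <- S) nu n `^ p.
have W0 : 0 < W by rewrite ltr_pwDl// sumr_ge0// => n _; exact: powR_ge0.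
have [|d Hd cd] := H (e / W); first by rewrite divr_gt0.
rewrite (le_trans (y := \sum_(n <- S) (pn (d n) * nu n `^ p + e / W * nu n `^ p)))//.
  apply: ler_sum => n _; rewrite -mulrDl ler_wpM2r ?powR_ge0//.
  by rewrite -[c n](subrK (d n)) (le_trans (pnD _ _))// addrC lerD2l cd.
rewrite big_split lerD ?Hd//= -mulr_sumr -mulrA ler_piMr ?(ltW e0)//.
by rewrite ler_pdivrMl// mulr1 /W lerDr.
Qed.

(** If [S0] comes within [e] of the supremum of the partial sums, then a list disjoint from [S0]
    adds at most [e]. *)
Lemma pbound_tail c C : pbound c C -> forall e : R, 0 < e ->
  exists N, forall S, uniq S -> (forall n : int, n \in S -> (N < `|n|)%N) ->
  \sum_(n <- S) pn (c n) * nu n `^ p <= e.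
Proof.
move=> Hc e e0.
pose X := [set x : R | exists2 S : seq int, uniq S &
  x = \sum_(n <- S) pn (c n) * nu n `^ p].
have supX : has_sup X.
  split; first by exists 0, [::]; rewrite ?big_nil.
  by exists C => _ [S uS ->]; exact: Hc.
have [_ [S0 uS0 ->] HS0] := sup_adherent e0 supX.
(* This sum dominates [|n|] for each [n] in [S0], hence forces [S] to be disjoint from [S0]. *)
exists (\sum_(n <- S0) `|n|%N) => S uS SN.
have uSS : uniq (S0 ++ S).
  rewrite cat_uniq uS0 uS andbT /=; apply/hasPn => n nS; apply/negP => nS0.
  have := SN n nS; rewrite ltnNge (big_rem n)//= leq_addr//.
have : \sum_(n <- S0 ++ S) pn (c n) * nu n `^ p <= sup X.
  by apply: sup_upper_bound => //; exists (S0 ++ S).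
rewrite big_cat /= => H; move: HS0; rewrite ltrBlDr => HS0.
by rewrite -(lerD2l (\sum_(n <- S0) pn (c n) * nu n `^ p)) (le_trans H)// ltW.
Qed.

Lemma pboundP c : (exists C, pbound c C) <->
  (\esum_(n in [set: int]) (pn (c n) * nu n `^ p)%:E < +oo)%E.
Proof.
split=> [[C Hc]|H].
  rewrite (@le_lt_trans _ _ C%:E) ?ltry//; apply: ge_ereal_sup.
  move=> _ [S [finS _] <-]; rewrite fsbig_finite//= sumEFin lee_fin.
  exact/Hc/finmap.fset_uniq.
have H0 : (0 <= \esum_(n in [set: int]) (pn (c n) * nu n `^ p)%:E)%E.
  by apply: esum_ge0 => n _; rewrite lee_fin mulr_ge0 ?pn_ge0 ?powR_ge0.
exists (fine (\esum_(n in [set: int]) (pn (c n) * nu n `^ p)%:E)) => S uS.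
rewrite -lee_fin fineK ?ge0_fin_numE//; apply: esum_ge.
exists [set` S]; first by split => //; exact: finite_seq.
by rewrite -fsbig_seq// sumEFin.
Qed.

End WeightedSums.
End PowerNorm.

(** * Neumann series *)

Section Multipliers.
Context {R : realType} {A : unitalBanachAlgType R[i]}.
Variables (p : R) (p_gt0 : 0 < p) (p_le1 : p <= 1).
Variables (nu : int -> R) (nu_weight : weight nu).
Variables (K sigma : R) (K_ge0 : 0 <= K) (sigma_ge1 : 1 <= sigma).
(** [D.*2.+1] counts the possible exponents in degree [D], so a sup bound on a Laurent polynomial
    becomes a weighted bound at the price [K * sigma ^+ D]. *)
Hypothesis nu_growth : forall D (n : int), (`|n| <= D)%N ->
  D.*2.+1%:R * nu n `^ p <= K * sigma ^+ D.
Implicit Types (F G T : R[i] -> A) (B c : R).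

Notation pn := (pn p).
Notation pbound := (pbound p nu).

Let sigma_ge0 : 0 <= sigma. Proof. exact: le_trans sigma_ge1. Qed.

Lemma laurent_pbound D T B : laurent D T ->
  (forall z, circle z -> pn (T z) <= B) ->
  pbound (fourier_coef T) (K * sigma ^+ D * B).
Proof.
move=> LT TB S uS.
have B0 : 0 <= B by rewrite (le_trans (pn_ge0 _ _) (TB _ circle1)).
have coefB n : pn (fourier_coef T n) <= B.
  rewrite pn_leV//; apply: fourier_coef_bound (laurent_has_fourier LT) _ => z cz.
  by rewrite -pn_leV// TB.
rewrite (bigID (fun n : int => (`|n| <= D)%N)) /= [X in _ + X]big1 ?addr0; last first.
  by move=> n; rewrite -ltnNge => /(laurent_coef_eq0 LT) ->; rewrite pn0// mul0r.
have D0 : 0 < D.*2.+1%:R :> R by rewrite ltr0n.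
pose b : R := K * sigma ^+ D * B / D.*2.+1%:R.
have b0 : 0 <= b by rewrite divr_ge0// !mulr_ge0// exprn_ge0.
rewrite (le_trans (y := \sum_(n <- [seq n <- S | (`|n| <= D)%N]) b))//.
  rewrite big_filter; apply: ler_sum => n nD.
  rewrite /b ler_pdivlMr// -[leLHS]mulrA [leRHS]mulrC; apply: ler_pM => //.
  - exact: pn_ge0.
  - by rewrite mulr_ge0 ?powR_ge0// ltW.
  - by rewrite mulrC nu_growth.
rewrite big_const_seq iter_addr_0 count_predT -[_ *+ _]mulr_natl /b mulrCA.
rewrite -[leRHS]mulr1 ler_wpM2l ?mulr_ge0 ?exprn_ge0//.
rewrite mulrC ler_pdivrMl// mulr1 ler_nat -size_irange uniq_leq_size ?filter_uniq//.
by move=> n; rewrite mem_filter mem_irange => /andP[].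
Qed.

(* The bound is required for all left factors T so that it can be iterated:
   multiplying G by a Laurent polynomial only changes T. *)
Definition multiplier G c := (exists D, laurent D G) /\
  forall D T B, laurent D T -> (forall z, circle z -> pn (T z) <= B) ->
  pbound (fourier_coef (fun z => bmul (T z) (G z))) (c * sigma ^+ D * B).

Lemma multiplier_pbound G c : multiplier G c ->
  pbound (fourier_coef G) (c * pn (bone : A)).
Proof.
move=> [_ /(_ 0%N (fun=> bone) _ (laurent_cst _ _) (fun _ _ => lexx _))].
rewrite expr0 mulr1; apply: eq_pbound => n.
by apply: eq_fourier_coef => z _; rewrite bmul1x.
Qed.

Lemma eq_multiplier G H c : (forall z, circle z -> G z = H z) ->
  multiplier G c -> multiplier H c.
Proof.
move=> GH [[D LG] MG]; split; first by exists D; exact: eq_laurent LG.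
move=> E T B LT TB; apply: eq_pbound (MG _ _ _ LT TB) => n.
by apply: eq_fourier_coef => z cz; rewrite GH.
Qed.

Lemma le_multiplier G c c' : c <= c' -> multiplier G c -> multiplier G c'.
Proof.
move=> cc' [LG MG]; split => // D T B LT TB; apply: le_pbound (MG _ _ _ LT TB).
have B0 : 0 <= B by rewrite (le_trans (pn_ge0 _ _) (TB _ circle1)).
by rewrite ler_wpM2r// ler_wpM2r// exprn_ge0.
Qed.

Lemma multiplierD G H c d : multiplier G c -> multiplier H d ->
  multiplier (fun z => G z + H z) (c + d).
Proof.
move=> [[D LG] MG] [[E LH] MH]; split.
  exists (D + E)%N; apply: laurentD; first exact: leq_laurent (leq_addr _ _) LG.
  exact: leq_laurent (leq_addl _ _) LH.
move=> F T B LT TB; rewrite !mulrDl.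
apply: eq_pbound (pboundD p_gt0 p_le1 (MG _ _ _ LT TB) (MH _ _ _ LT TB)) => n.
rewrite -fourier_coefD; first by apply: eq_fourier_coef => z _; rewrite bmulDr.
- exact: laurent_has_fourier (laurentM LT LG).
- exact: laurent_has_fourier (laurentM LT LH).
Qed.

Lemma multiplier_laurent D G B : laurent D G ->
  (forall z, circle z -> pn (G z) <= B) -> multiplier G (K * sigma ^+ D * B).
Proof.
move=> LG GB; split; first by exists D.
move=> E T B' LT TB.
have -> : K * sigma ^+ D * B * sigma ^+ E * B' = K * sigma ^+ (E + D) * (B' * B).
  by rewrite exprD; ring.
apply: laurent_pbound; first exact: laurentM.
by move=> z cz; rewrite (le_trans (pnM _ _ _))// ler_pM ?pn_ge0 ?TB ?GB.
Qed.

Lemma multiplierM D G H B c : laurent D H ->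
  (forall z, circle z -> pn (H z) <= B) -> multiplier G c ->
  multiplier (fun z => bmul (H z) (G z)) (c * (sigma ^+ D * B)).
Proof.
move=> LH HB [[E LG] MG]; split; first by exists (D + E)%N; exact: laurentM.
move=> F T B' LT TB.
have -> : c * (sigma ^+ D * B) * sigma ^+ F * B' = c * sigma ^+ (F + D) * (B' * B).
  by rewrite exprD; ring.
have := MG _ _ (B' * B) (laurentM LT LH) => H'.
apply: eq_pbound (H' _) => [n|z cz].
  by apply: eq_fourier_coef => z _; rewrite bmulA.
by rewrite (le_trans (pnM _ _ _))// ler_pM ?pn_ge0 ?TB ?HB.
Qed.

(** Multiplication by the central [z ^ n] shifts the coefficients, so it costs the weight of [n] and
    no power of [sigma]. High frequencies thus do not count as degree. *)
Lemma multiplier_shift G c (n : int) : multiplier G c ->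
  multiplier (fun z => z ^ n *: G z) (c * nu n `^ p).
Proof.
move=> [[D LG] MG]; split.
  exists (`|n| + D)%N; apply: eq_laurent (laurentM (laurent_monomial n bone) LG).
  by move=> z _; rewrite -bscalerAl bmul1x.
move=> E T B LT TB.
have -> : c * nu n `^ p * sigma ^+ E * B = nu n `^ p * (c * sigma ^+ E * B) by ring.
apply: eq_pbound (pbound_shift p_gt0 nu_weight n (MG _ _ _ LT TB)) => m.
rewrite -fourier_coef_shift; apply: eq_fourier_coef => z _.
by rewrite bscalerAr.
Qed.

Lemma multiplier0 : multiplier (fun=> 0) 0.
Proof.
rewrite -[X in multiplier _ X](mulr0 (K * sigma ^+ 0)).
by apply: multiplier_laurent (laurent_cst 0 0) _ => z _; rewrite pn0.
Qed.

Lemma multiplier_sum (I : eqType) (r : seq I) (G : I -> R[i] -> A) (c : I -> R) :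
  (forall i, i \in r -> multiplier (G i) (c i)) ->
  multiplier (fun z => \sum_(i <- r) G i z) (\sum_(i <- r) c i).
Proof.
elim: r => [_|i r IH H].
  by rewrite big_nil; apply: eq_multiplier multiplier0 => z _; rewrite big_nil.
rewrite big_cons; apply: eq_multiplier (multiplierD (H i (mem_head _ _)) (IH _)).
  by move=> z _; rewrite big_cons.
by move=> j jr; apply: H; rewrite inE jr orbT.
Qed.

Section Perturbation.
Variables (a : int -> A) (d : nat) (h0 q : R[i] -> A) (rho0 Q : R).
Hypotheses (h0_laurent : laurent d h0) (q_laurent : laurent d q).
Hypothesis h0_le : forall z, circle z -> pn (h0 z) <= rho0.
Hypothesis q_le : forall z, circle z -> pn (q z) <= Q.

Definition fsum (S : seq int) z : A := \sum_(n <- S) z ^ n *: a n.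

Definition fmass (S : seq int) : R := \sum_(n <- S) pn (a n) * nu n `^ p.

(** In the application [h0 = 1 - q f_N] and [S] lists frequencies beyond [N], so this is [1 - q f]
    with [f] truncated; [perturb_pow S k] is the [k]-th Neumann term, its [k]-th power times [q]. *)
Definition perturb S z := h0 z - bmul (q z) (fsum S z).

Definition perturb_pow S k z := iter k (bmul (perturb S z)) (q z).

Let Q_ge0 : 0 <= Q. Proof. by rewrite (le_trans (pn_ge0 _ _) (q_le circle1)). Qed.

Let rho0_ge0 : 0 <= rho0.
Proof. by rewrite (le_trans (pn_ge0 _ _) (h0_le circle1)). Qed.

Lemma fmass_ge0 S : 0 <= fmass S.
Proof. by rewrite sumr_ge0// => n _; rewrite mulr_ge0 ?pn_ge0 ?powR_ge0. Qed.

Lemma multiplier_tail G c S : multiplier G c ->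
  multiplier (fun z => - bmul (bmul (q z) (fsum S z)) (G z))
    (c * (sigma ^+ d * Q * fmass S)).
Proof.
move=> MG; have -> : c * (sigma ^+ d * Q * fmass S) =
    \sum_(n <- S) c * (sigma ^+ (d + 0) * (Q * pn (- a n))) * nu n `^ p.
  rewrite !mulr_sumr; apply: eq_bigr => n _; rewrite pnN addn0; ring.
have M n : multiplier (fun z => z ^ n *: bmul (bmul (q z) (- a n)) (G z))
    (c * (sigma ^+ (d + 0) * (Q * pn (- a n))) * nu n `^ p).
  apply: multiplier_shift; apply: multiplierM MG.
    by apply: laurentM => //; exact: laurent_cst.
  by move=> z cz; rewrite (le_trans (pnM _ _ _))// ler_wpM2r ?pn_ge0 ?q_le.
apply: eq_multiplier (multiplier_sum (fun n _ => M n)) => z _.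
rewrite /fsum bmul_sumr bmul_suml -sumrN; apply: eq_bigr => n _.
by rewrite bmulxN bmulNx scalerN -bscalerAr -bscalerAl.
Qed.

Lemma multiplier_perturb G c S : multiplier G c ->
  multiplier (fun z => bmul (perturb S z) (G z))
    (c * (sigma ^+ d * (rho0 + Q * fmass S))).
Proof.
move=> MG; rewrite mulrDr mulrDr [X in _ + c * X]mulrA.
apply: eq_multiplier
  (multiplierD (multiplierM h0_laurent h0_le MG) (multiplier_tail S MG)) => z _.
by rewrite bmulBl.
Qed.

Lemma multiplier_pow S kappa k : sigma ^+ d * (rho0 + Q * fmass S) <= kappa ->
  multiplier (perturb_pow S k) (K * sigma ^+ d * Q * kappa ^+ k).
Proof.
move=> kap; have c0 : 0 <= K * sigma ^+ d * Q by rewrite !mulr_ge0// exprn_ge0.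
have kap0 : 0 <= kappa.
  rewrite (le_trans _ kap)// mulr_ge0 ?exprn_ge0// addr_ge0// mulr_ge0//.
  exact: fmass_ge0.
elim: k => [|k IH].
  by rewrite expr0 mulr1; exact: multiplier_laurent q_laurent q_le.
apply: le_multiplier (multiplier_perturb S IH).
by rewrite exprSr [leRHS]mulrA ler_wpM2l// mulr_ge0// exprn_ge0.
Qed.

Lemma fsum_cat S1 S2 z : fsum (S1 ++ S2) z = fsum S1 z + fsum S2 z.
Proof. exact: big_cat. Qed.

Lemma fmass_cat S1 S2 : fmass (S1 ++ S2) = fmass S1 + fmass S2.
Proof. exact: big_cat. Qed.

Lemma perturb_cat S1 S2 z :
  perturb (S1 ++ S2) z = perturb S1 z - bmul (q z) (fsum S2 z).
Proof. by rewrite /perturb fsum_cat bmulDr opprD addrA. Qed.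

(** With [h' = perturb (S1 ++ S2)] and [h = perturb S1], induct along [h'^(k+1) q - h^(k+1) q = h'
    (h'^k q - h^k q) + (h' - h) h^k q]. The naive bound grows like [k kappa^(k-1)]; the larger ratio
    [kappa1] absorbs the factor [k]. *)
Lemma multiplier_powB S1 S2 kappa kappa1 M k :
  sigma ^+ d * (rho0 + Q * fmass (S1 ++ S2)) <= kappa ->
  kappa <= kappa1 ->
  K * sigma ^+ d * Q * (sigma ^+ d * Q) <= M * (kappa1 - kappa) ->
  0 <= M ->
  multiplier (fun z => perturb_pow (S1 ++ S2) k z - perturb_pow S1 k z)
    (M * fmass S2 * kappa1 ^+ k).
Proof.
move=> kap kap1 MK M0.
have kapS1 : sigma ^+ d * (rho0 + Q * fmass S1) <= kappa.
  rewrite (le_trans _ kap)// ler_wpM2l ?exprn_ge0// lerD2l ler_wpM2l//.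
  by rewrite fmass_cat lerDl fmass_ge0.
have kap_ge0 : 0 <= kappa.
  rewrite (le_trans _ kapS1)// mulr_ge0 ?exprn_ge0// addr_ge0// mulr_ge0//.
  exact: fmass_ge0.
have tau0 := fmass_ge0 S2.
elim: k => [|k IH].
  rewrite expr0 mulr1; apply: le_multiplier (mulr_ge0 M0 tau0) _.
  by apply: eq_multiplier multiplier0 => z _; rewrite /= subrr.
have H := multiplierD (multiplier_perturb (S1 ++ S2) IH)
  (multiplier_tail S2 (multiplier_pow k kapS1)).
apply: le_multiplier (eq_multiplier _ H) => [|z _]; last first.
  rewrite [RHS]/= bmulBr -addrA; congr (_ + _).
  by rewrite perturb_cat bmulBl opprB addrAC subrr add0r.

have c0 : 0 <= K * sigma ^+ d * Q by rewrite !mulr_ge0// exprn_ge0.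
have Mt0 : 0 <= M * fmass S2 by rewrite mulr_ge0.
(* Split [kappa1 = kappa + (kappa1 - kappa)]: the first part pays for the induction hypothesis, the
   second for the new term through the condition on [M]. *)
rewrite (le_trans (y := M * fmass S2 * kappa1 ^+ k * kappa +
  M * (kappa1 - kappa) * fmass S2 * kappa1 ^+ k))//; last first.
  by rewrite exprS le_eqVlt; apply/orP; left; apply/eqP; ring.
apply: lerD.
  by rewrite ler_wpM2l// mulr_ge0// exprn_ge0// (le_trans kap_ge0).
have -> : K * sigma ^+ d * Q * kappa ^+ k * (sigma ^+ d * Q * fmass S2) =
  K * sigma ^+ d * Q * (sigma ^+ d * Q) * fmass S2 * kappa ^+ k by ring.
have sQ : 0 <= sigma ^+ d * Q by rewrite mulr_ge0// exprn_ge0.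
apply: ler_pM => //; [|by rewrite exprn_ge0| |].
- by rewrite !mulr_ge0// exprn_ge0.
- by rewrite ler_wpM2r.
- by rewrite lerXn2r// nnegrE// (le_trans kap_ge0).
Qed.

End Perturbation.

End Multipliers.

(** * Uniform limits in the weighted space and tails of Fourier series *)

Section UniformLimits.
Context {R : realType} {A : unitalBanachAlgType R[i]}.
Variables (p : R) (p_gt0 : 0 < p) (p_le1 : p <= 1).
Variables (nu : int -> R) (nu_weight : weight nu).
Implicit Types (F g : R[i] -> A).

Notation pn := (pn p).
Notation pbound := (pbound p nu).

Lemma pn_fsum_le c C z S : circle z -> uniq S -> pbound c C ->
  pn (\sum_(n <- S) z ^ n *: (c n : A)) <= C.
Proof.
move=> cz uS Hc; rewrite (le_trans (pn_sum p_gt0 p_le1 _ _ _))//.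
rewrite (le_trans _ (pbound_sum_pn p_gt0 nu_weight Hc uS))//.
by apply: ler_sum => n _; rewrite pnZ_circle//; exact: circleX.
Qed.

Lemma pn_laurent_le D F C z : laurent D F -> pbound (fourier_coef F) C ->
  circle z -> pn (F z) <= C.
Proof.
move=> LF HF cz; rewrite -(laurent_expansion LF (leqnn D) cz).
exact: pn_fsum_le (irange_uniq D) HF.
Qed.

Lemma cvg_pnP (u : nat -> A) (l : A) : (u @ \oo --> l) <->
  (forall e : R, 0 < e -> exists N, forall n, (N <= n)%N -> pn (u n - l) <= e).
Proof.
rewrite cvg_rnormP; split=> H e e0.
  have [|N HN] := H (e `^ p^-1); first by rewrite powR_gt0.
  by exists N => n /HN/ltW; rewrite -pn_leV// ltW.
have e20 : 0 < e / 2 by rewrite divr_gt0.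
have [|N HN] := H ((e / 2) `^ p); first by rewrite powR_gt0.
exists N => n /HN; rewrite pn_le ?(ltW e20)// => /le_lt_trans; apply.
by rewrite ltr_pdivrMr// mulr_natr mulr2n ltrDl.
Qed.

Lemma laurent_limit_pn F :
  (forall e : R, 0 < e -> exists D G, laurent D G /\
     forall z, circle z -> pn (F z - G z) <= e) ->
  laurent_limit F.
Proof.
move=> H e e0; have [|D [G [LG FG]]] := H (e `^ p); first by rewrite powR_gt0.
by exists D, G; split => // z cz; rewrite -(pn_le p_gt0) ?FG// ltW.
Qed.

Lemma pn_fourier_coef_le F e n : has_fourier F -> 0 <= e ->
  (forall z, circle z -> pn (F z) <= e) -> pn (fourier_coef F n) <= e.
Proof.
move=> HF e0 Fe; rewrite pn_leV//; apply: fourier_coef_bound HF _ => z cz.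
by rewrite -pn_leV// Fe.
Qed.

(** Completeness of the weighted space. As [nu >= 1], the coefficient mass dominates [pn] uniformly
    on the circle, so the sequence converges uniformly; the mass bounds pass to the limit by
    [pbound_limit]. *)
Lemma pbound_cauchy_limit (G : nat -> R[i] -> A) :
  (forall j, exists D, laurent D (G j)) ->
  (forall j, exists C, pbound (fourier_coef (G j)) C) ->
  (forall e : R, 0 < e -> exists J, forall i j, (J <= i)%N -> (i <= j)%N ->
     pbound (fourier_coef (fun z => G j z - G i z)) e) ->
  exists g, [/\ continuous_on_circle g, p_abs_conv_fourier p nu g &
    forall e : R, 0 < e -> exists J, forall j z, (J <= j)%N -> circle z ->
      pn (G j z - g z) <= e].
Proof.
move=> LG bG cG.
have LG2 i j : exists D, laurent D (fun z => G j z - G i z).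
  have [[D Li] [E Lj]] := (LG i, LG j); exists (D + E)%N.
  by apply: laurentB; [apply: leq_laurent Lj|apply: leq_laurent Li];
    rewrite ?leq_addl ?leq_addr.
have sG e : 0 < e -> exists J, forall i j z, (J <= i)%N -> (J <= j)%N ->
    circle z -> pn (G j z - G i z) <= e.
  move=> e0; have [J HJ] := cG _ e0; exists J => i j z.
  wlog ij : i j / (i <= j)%N.
    move=> W Ji Jj cz; case/orP: (leq_total i j) => ij; first exact: W.
    by rewrite pnB; exact: W.
  move=> Ji Jj cz; have [D L] := LG2 i j.
  exact: pn_laurent_le L (HJ i j Ji ij) cz.
have /choice[g gP] : forall z : R[i], exists l : A, circle z ->
    (fun j => G j z) @ \oo --> l.
  move=> z; have [cz|ncz] := pselect (circle z); last by exists 0.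
  have [e e0|l Hl] := @rnorm_cauchy_cvg _ _ (fun j => G j z).
    have e20 : 0 < e / 2 by rewrite divr_gt0.
    have [|J HJ] := sG ((e / 2) `^ p); first by rewrite powR_gt0.
    exists J => m n Jm Jn; have := HJ n m z Jn Jm cz.
    rewrite pn_le ?(ltW e20)// => /le_lt_trans; apply.
    by rewrite ltr_pdivrMr// mulr_natr mulr2n ltrDl.
  by exists l => _; apply/cvg_rnormP.
have sg e : 0 < e -> exists J, forall j z, (J <= j)%N -> circle z ->
    pn (G j z - g z) <= e.
  move=> e0; have [J HJ] := sG _ e0; exists J => j z Jj cz.
  apply/ler_addgt0Pr => e' e'0.
  have [N HN] := (cvg_pnP _ _).1 (gP z cz) _ e'0.
  rewrite (le_trans (pn_dist p_gt0 p_le1 (G (maxn N J) z) _ _))// lerD//.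
    by rewrite HJ// leq_maxr.
  by rewrite HN// leq_maxl.
have limg : laurent_limit g.
  apply: laurent_limit_pn => e /sg[J HJ]; have [D L] := LG J.
  by exists D, (G J); split => // z cz; rewrite pnB HJ.
have Hg := laurent_limit_has_fourier limg.
have HG j : has_fourier (G j).
  by have [D /laurent_has_fourier] := LG j.
(* Let [j] tend to infinity in the Cauchy estimate: uniform convergence entails convergence of the
   coefficients. *)
have cg e i : 0 < e -> (forall j, (i <= j)%N ->
    pbound (fourier_coef (fun z => G j z - G i z)) e) ->
    pbound (fun n => fourier_coef g n - fourier_coef (G i) n) e.
  move=> e0 Hi; apply: (pbound_limit p_gt0 p_le1) => e' e'0.
  have [J HJ] := sg _ e'0.
  exists (fun n => fourier_coef (G (maxn i J)) n - fourier_coef (G i) n).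
    apply: eq_pbound (Hi _ (leq_maxl i J)) => n.
    by rewrite (fourier_coefB n (HG _) (HG _)).
  move=> n; rewrite opprB addrA subrK pnB -(fourier_coefB n (HG _) Hg).
  apply: pn_fourier_coef_le; [exact: has_fourierB|exact: ltW|].
  by move=> z cz; rewrite HJ// leq_maxr.
exists g; split => //; first exact: laurent_limit_continuous.
split=> [z cz|].
  apply/cvg_pnP => e e0; have e20 : 0 < e / 2 by rewrite divr_gt0.
  have [[J1 HJ1] [J2 HJ2]] := (cG _ e20, sg _ e20).
  pose i := maxn J1 J2; have [D L] := LG i.
  exists D => N DN; rewrite fourier_partial_sumE.
  rewrite (le_trans (pn_dist p_gt0 p_le1 (G i z) _ _))// (splitr e) lerD//.
    (* The Laurent polynomial [G i] equals its own partial sum once [N >= D], so only the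
       coefficients of [g - G i] remain. *)
    rewrite -(laurent_expansion L DN cz) -sumrB.
    under eq_bigr do rewrite -scalerBr.
    apply: pn_fsum_le cz (irange_uniq N) _; apply: cg => // j ij.
    by apply: HJ1 => //; rewrite leq_maxl.
  by rewrite HJ2// leq_maxr.
apply/(pboundP p nu (fourier_coef g)).
have [J HJ] := cG _ ltr01; have [C HC] := bG J.
have := pboundD p_gt0 p_le1 (cg _ _ ltr01 (fun j => HJ J j (leqnn J))) HC.
by move=> H; exists (1 + C); apply: eq_pbound H => n; rewrite subrK.
Qed.

(** Pointwise convergence provides a far partial sum, depending on [z], that is close to [F z]; the
    frequencies in between have mass at most [e], which makes the bound uniform in [z]. *)
Lemma fourier_series_pn_tail F a C : (forall n, a n = fourier_coef F n) ->
  (forall z, circle z -> fourier_partial_sum F z @ \oo --> F z) ->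
  pbound a C ->
  forall e : R, 0 < e -> exists N, forall i z, (N <= i)%N -> circle z ->
    pn (F z - fsum a (irange i) z) <= e.
Proof.
move=> aF cvF Ha e e0.
have [N HN] := pbound_tail Ha e0; exists N => i z Ni cz.
apply/ler_addgt0Pr => e' e'0; rewrite [leRHS]addrC.
have [M HM] := (cvg_pnP _ _).1 (cvF z cz) _ e'0.
pose j := maxn M i; have ij : (i <= j)%N by rewrite leq_maxr.
rewrite (le_trans (pn_dist p_gt0 p_le1 (fsum a (irange j) z) _ _))// lerD//.
  rewrite pnB; have := HM j (leq_maxl _ _); rewrite fourier_partial_sumE.
  by under eq_bigr do rewrite -aF.
rewrite /fsum (perm_big _ (irange_split ij)) big_cat /= addrAC subrr add0r.
rewrite (le_trans (pn_sum p_gt0 p_le1 _ _ _))//.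
rewrite (le_trans _ (HN [seq n <- irange j | (i < `|n|)%N] _ _))//.
- apply: ler_sum => n _; rewrite pnZ_circle; last exact: circleX.
  by rewrite ler_peMr ?pn_ge0// weight_powR_ge1.
- by rewrite filter_uniq// irange_uniq.
- by move=> n; rewrite mem_filter => /andP[ni _]; exact: leq_ltn_trans ni.
Qed.

End UniformLimits.

(** * Elementary real estimates and the telescoping Neumann sum *)

Section RealEstimates.
Context {R : realType}.

Lemma bernoulli (x : R) n : 0 <= x -> 1 + n%:R * x <= (1 + x) ^+ n.
Proof.
move=> x0; elim: n => [|n IH]; first by rewrite expr0 mul0r addr0.
have x1 : 0 <= 1 + x by rewrite addr_ge0.
rewrite exprS (le_trans _ (ler_wpM2l x1 IH))// -subr_ge0.
have -> : (1 + x) * (1 + n%:R * x) - (1 + n.+1%:R * x) = n%:R * x ^+ 2.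
  by rewrite -natr1; ring.
by rewrite mulr_ge0// sqr_ge0.
Qed.

(** By Bernoulli [s ^+ n >= 1 + n (s - 1)], and [K = 1 + 2 / (s - 1)] raises the slope to at least
    2. *)
Lemma linear_le_geometric (s : R) : 1 < s ->
  exists2 K : R, 0 <= K & forall n, n.*2.+1%:R <= K * s ^+ n.
Proof.
move=> s1; have s0 : 0 < s - 1 by rewrite subr_gt0.
exists (1 + 2 / (s - 1)) => [|n]; first by rewrite addr_ge0// divr_ge0// ltW.
have := bernoulli n (ltW s0); rewrite subrKC => H.
rewrite (le_trans _ (ler_wpM2l _ H))//; last first.
  by rewrite addr_ge0// divr_ge0// ltW.
have -> : (1 + 2 / (s - 1)) * (1 + n%:R * (s - 1)) =
    1 + n%:R * 2 + (n%:R * (s - 1) + 2 / (s - 1)).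
  by field; rewrite lt0r_neq0.
rewrite -muln2 -natr1 natrM addrC lerDl.
have s00 := ltW s0; by rewrite addr_ge0// mulr_ge0// invr_ge0.
Qed.

Lemma geometric_sum_le (x : R) i j : 0 <= x -> x < 1 -> (i <= j)%N ->
  \sum_(i <= k < j) x ^+ k <= x ^+ i / (1 - x).
Proof.
move=> x0 x1 ij; have x10 : 0 < 1 - x by rewrite subr_gt0.
rewrite ler_pdivlMr//.
suff -> : (\sum_(i <= k < j) x ^+ k) * (1 - x) = x ^+ i - x ^+ j.
  by rewrite gerBl exprn_ge0.
rewrite mulr_suml -[RHS]opprB -(telescope_sumr (fun k => x ^+ k) ij) -sumrN.
by apply: eq_bigr => k _; rewrite exprS; ring.
Qed.

Lemma pow_small (x e : R) : 0 <= x -> x < 1 -> 0 < e ->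
  exists N, forall n, (N <= n)%N -> x ^+ n <= e.
Proof.
move=> x0 x1 e0.
have : (fun n => x ^+ n) @ \oo --> (0 : R) by apply: cvg_expr; rewrite ger0_norm.
move=> /cvgrPdist_le/(_ _ e0)[N _ HN]; exists N => n /HN /=.
by rewrite sub0r normrN ger0_norm// exprn_ge0.
Qed.

Lemma exp_root_exists (b : R) n : 1 < b -> exists2 s : R, 1 < s & s ^+ n.+1 = b.
Proof.
move=> b1; have b0 : 0 <= b by rewrite ltW// (lt_trans ltr01).
exists (b `^ n.+1%:R^-1); last first.
  by rewrite -powR_mulrn ?powR_ge0// -powRrM mulVf// powRr1.
have : 1 `^ n.+1%:R^-1 < b `^ n.+1%:R^-1.
  by rewrite gt0_ltr_powR ?nnegrE// invr_gt0.
by rewrite powR1.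
Qed.

End RealEstimates.

(** Since [q f = 1 - x], the [k]-th term times [f] is [x^k - x^(k+1)], and the sum telescopes. *)
Lemma geometric_series_left {R : realType} {A : unitalBanachAlgType R[i]}
    (q f x : A) j : bmul q f = bone - x ->
  bmul (\sum_(0 <= k < j) iter k (bmul x) q) f = bone - iter j (bmul x) bone.
Proof.
move=> qf; rewrite bmul_suml.
have E k : bmul (iter k (bmul x) q) f =
    iter k (bmul x) bone - iter k.+1 (bmul x) bone.
  elim: k => [|k IH]; first by rewrite /= qf bmulx1.
  by rewrite [iter k.+1 _ q]/= -bmulA IH bmulBr.
elim: j => [|j IH]; first by rewrite big_geq// subrr.
by rewrite big_nat_recr//= IH E addrA subrK.
Qed.

Lemma pn_iter_le {R : realType} {A : unitalBanachAlgType R[i]} (p kappa : R)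
    (x y : A) j : 0 < p -> pn p x <= kappa ->
  pn p (iter j (bmul x) y) <= kappa ^+ j * pn p y.
Proof.
move=> p0 xk; elim: j => [|j IH]; first by rewrite expr0 mul1r.
by rewrite /= (le_trans (pnM p0 _ _))// exprS -mulrA ler_pM ?pn_ge0.
Qed.

(** * Truncated Neumann series *)

Section PerturbationSeries.
Context {R : realType} {A : unitalBanachAlgType R[i]}.
Variables (p : R) (p_gt0 : 0 < p) (p_le1 : p <= 1).
Variables (nu : int -> R) (nu_weight : weight nu).
Variables (K sigma : R) (K_ge0 : 0 <= K) (sigma_ge1 : 1 <= sigma).
Hypothesis nu_growth : forall D (n : int), (`|n| <= D)%N ->
  D.*2.+1%:R * nu n `^ p <= K * sigma ^+ D.
Variables (a : int -> A) (C : R) (a_pbound : pbound p nu a C).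
Variables (d : nat) (h0 q : R[i] -> A) (rho0 Q eta kappa : R) (N : nat).
Hypotheses (h0_laurent : laurent d h0) (q_laurent : laurent d q).
Hypothesis h0_le : forall z, circle z -> pn p (h0 z) <= rho0.
Hypothesis q_le : forall z, circle z -> pn p (q z) <= Q.
Hypothesis a_tail : forall S, uniq S ->
  (forall n : int, n \in S -> (N < `|n|)%N) -> fmass p nu a S <= eta.
Hypothesis kappa_le : sigma ^+ d * (rho0 + Q * eta) <= kappa.
Hypothesis kappa_lt1 : kappa < 1.

Definition tail_range j := [seq n <- irange j | (N < `|n|)%N].

(** A diagonal truncation: [j] bounds both the number of Neumann terms and the frequencies of [f],
    so each approximant is a Laurent polynomial. *)
Definition perturb_series j z :=
  \sum_(0 <= k < j) perturb_pow a h0 q (tail_range j) k z.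

Let Q_ge0 : 0 <= Q. Proof. by rewrite (le_trans (pn_ge0 _ _) (q_le circle1)). Qed.

Let sigma_ge0 : 0 <= sigma. Proof. exact: le_trans sigma_ge1. Qed.

Let sQ_ge0 : 0 <= sigma ^+ d * Q. Proof. by rewrite mulr_ge0// exprn_ge0. Qed.

Lemma tail_range_uniq j : uniq (tail_range j).
Proof. by rewrite filter_uniq// irange_uniq. Qed.

Lemma fmass_tail_range j : fmass p nu a (tail_range j) <= eta.
Proof.
by apply: a_tail (tail_range_uniq j) _ => n; rewrite mem_filter => /andP[].
Qed.

Let kappa_tail S : fmass p nu a S <= eta ->
  sigma ^+ d * (rho0 + Q * fmass p nu a S) <= kappa.
Proof.
move=> Seta; rewrite (le_trans _ kappa_le)// ler_wpM2l ?exprn_ge0//.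
by rewrite lerD2l ler_wpM2l.
Qed.

Lemma kappa_ge0 : 0 <= kappa.
Proof.
rewrite (le_trans _ (kappa_tail (fmass_tail_range 0)))// mulr_ge0 ?exprn_ge0//.
rewrite addr_ge0 ?(le_trans (pn_ge0 _ _) (h0_le circle1))//.
by rewrite mulr_ge0// fmass_ge0.
Qed.

Let multiplier_tail_pow j k : multiplier p nu sigma
  (perturb_pow a h0 q (tail_range j) k) (K * sigma ^+ d * Q * kappa ^+ k).
Proof.
apply: (multiplier_pow p_gt0 p_le1 nu_weight K_ge0 sigma_ge1 nu_growth
  h0_laurent q_laurent h0_le q_le).
exact/kappa_tail/fmass_tail_range.
Qed.

Lemma multiplier_perturb_series j : multiplier p nu sigma (perturb_series j)
  (\sum_(0 <= k < j) K * sigma ^+ d * Q * kappa ^+ k).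
Proof.
apply: (multiplier_sum p_gt0 p_le1 K_ge0 sigma_ge1 nu_growth) => k _.
exact: multiplier_tail_pow.
Qed.

Lemma tail_range_split i j : (N <= i)%N -> (i <= j)%N ->
  perm_eq (tail_range j)
    (tail_range i ++ [seq n <- irange j | (i < `|n|)%N]).
Proof.
move=> Ni ij; rewrite uniq_perm ?tail_range_uniq// => [|n].
  rewrite cat_uniq tail_range_uniq filter_uniq ?irange_uniq// andbT.
  apply/hasPn => n; rewrite !mem_filter !mem_irange => /andP[ni _].
  by apply/negP => /andP[_]; rewrite leqNgt ni.
rewrite mem_cat !mem_filter !mem_irange.
have [ni|ni] := leqP `|n|%N i; last by rewrite andbF (leq_ltn_trans Ni).
by rewrite (leq_trans ni ij) orbF.
Qed.

Lemma perm_perturb_pow S S' k : perm_eq S S' ->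
  perturb_pow a h0 q S k = perturb_pow a h0 q S' k.
Proof.
move=> SS'; have E : perturb a h0 q S = perturb a h0 q S'.
  by apply/funext => z; rewrite /perturb /fsum (perm_big _ SS').
by rewrite /perturb_pow E.
Qed.

(** The difference splits into the first [i] terms, whose powers differ only by the frequencies in
    [S'] ([multiplier_powB]), and the terms from [i] to [j], a geometric tail. *)
Lemma perturb_series_cauchy (e : R) : 0 < e ->
  exists J, forall i j, (J <= i)%N -> (i <= j)%N ->
  pbound p nu (fourier_coef (fun z => perturb_series j z - perturb_series i z)) e.
Proof.
move=> e0; pose kappa1 := (kappa + 1) / 2.
have kk1 : kappa < kappa1 := (midf_lt kappa_lt1).1.
have k11 : kappa1 < 1 := (midf_lt kappa_lt1).2.
have k1_ge0 : 0 <= kappa1 by rewrite (le_trans kappa_ge0)// ltW.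
have k1_gt0 : 0 < 1 - kappa1 by rewrite subr_gt0.
have kk1_gt0 : 0 < kappa1 - kappa by rewrite subr_gt0.
pose c0 := K * sigma ^+ d * Q.
have c0_ge0 : 0 <= c0 by rewrite !mulr_ge0// exprn_ge0.
pose M := c0 * (sigma ^+ d * Q) / (kappa1 - kappa).
have M_ge0 : 0 <= M := divr_ge0 (mulr_ge0 c0_ge0 sQ_ge0) (ltW kk1_gt0).
(* The two parts cost [M] and [c0] times [e / W / (1 - kappa1)], and [multiplier_pbound] adds the
   factor [pn bone]; the extra units keep [W] positive. *)
pose W := (M + c0 + 1) * (pn p (bone : A) + 1) / (1 - kappa1).
have W0 : 0 < W.
  rewrite divr_gt0// mulr_gt0//; first by rewrite ltr_wpDl// addr_ge0.
  by rewrite ltr_wpDl// pn_ge0.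
have eW : 0 < e / W by rewrite divr_gt0.
have [J1 HJ1] := pbound_tail a_pbound eW.
have [J2 HJ2] := pow_small k1_ge0 k11 eW.
exists (maxn N (maxn J1 J2)) => i j; rewrite !geq_max => /and3P[Ni J1i J2i] ij.
pose S' := [seq n <- irange j | (i < `|n|)%N].
have S'le : fmass p nu a S' <= e / W.
  apply: HJ1; first by rewrite filter_uniq// irange_uniq.
  by move=> n; rewrite mem_filter => /andP[ni _]; exact: leq_ltn_trans ni.
have H1 : multiplier p nu sigma
    (fun z => \sum_(k <- index_iota 0 i) (perturb_pow a h0 q (tail_range j) k z -
       perturb_pow a h0 q (tail_range i) k z))
    (\sum_(k <- index_iota 0 i) M * fmass p nu a S' * kappa1 ^+ k).
  apply: (multiplier_sum p_gt0 p_le1 K_ge0 sigma_ge1 nu_growth) => k _.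
  rewrite (perm_perturb_pow k (tail_range_split Ni ij)).
  apply: (multiplier_powB p_gt0 p_le1 nu_weight K_ge0 sigma_ge1 nu_growth
    h0_laurent q_laurent h0_le q_le (kappa := kappa)) => //.
  - apply: kappa_tail; rewrite /fmass -(perm_big _ (tail_range_split Ni ij)).
    exact: fmass_tail_range.
  - exact: ltW.
  - by rewrite /M divfK// lt0r_neq0.
have H2 : multiplier p nu sigma
    (fun z => \sum_(k <- index_iota i j) perturb_pow a h0 q (tail_range j) k z)
    (\sum_(k <- index_iota i j) c0 * kappa1 ^+ k).
  apply: (multiplier_sum p_gt0 p_le1 K_ge0 sigma_ge1 nu_growth) => k _.
  apply: (le_multiplier sigma_ge1) (multiplier_tail_pow j k).
  by rewrite ler_wpM2l// lerXn2r ?nnegrE ?kappa_ge0// ltW.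
have H := multiplier_pbound (multiplierD p_gt0 p_le1 H1 H2).
apply: eq_pbound (le_pbound _ H) => [n|].
  apply: eq_fourier_coef => z _; by rewrite sumrB addrAC -big_cat_nat.
have b0 := pn_ge0 p (bone : A).
have g1 : \sum_(k <- index_iota 0 i) M * fmass p nu a S' * kappa1 ^+ k <=
    M * (e / W) / (1 - kappa1).
  rewrite -mulr_sumr; apply: ler_pM.
  - by rewrite mulr_ge0// fmass_ge0.
  - by rewrite sumr_ge0// => k _; rewrite exprn_ge0.
  - by rewrite ler_wpM2l.
  - have := geometric_sum_le k1_ge0 k11 (leq0n i).
    by rewrite expr0 mul1r.
have g2 : \sum_(k <- index_iota i j) c0 * kappa1 ^+ k <=
    c0 * (e / W) / (1 - kappa1).
  rewrite -mulr_sumr -[leRHS]mulrA ler_wpM2l//.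
  rewrite (le_trans (geometric_sum_le k1_ge0 k11 ij))//.
  by rewrite ler_wpM2r ?invr_ge0 ?HJ2// ltW.
rewrite (le_trans (ler_wpM2r b0 (lerD g1 g2)))//.
have eE : e = W * (e / W) by rewrite mulrC divfK// lt0r_neq0.
rewrite [leRHS]eE -subr_ge0; move: (e / W) (ltW eW) => x x0.
have -> : W * x - (M * x / (1 - kappa1) + c0 * x / (1 - kappa1)) * pn p (bone : A) =
    (M + c0 + pn p (bone : A) + 1) * x / (1 - kappa1).
  by rewrite /W; field; rewrite lt0r_neq0.
by rewrite divr_ge0 ?(ltW k1_gt0)// mulr_ge0// !addr_ge0.
Qed.

Hypothesis h0E : forall z, h0 z = bone - bmul (q z) (fsum a (irange N) z).

(** With [f_j] the partial sum of [f] and [x] the matching perturbation, [q f_j = 1 - x]. The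
    truncated series therefore inverts [f_j] up to [x^j], and [pn x <= kappa]. *)
Lemma perturb_series_inverse j z : (N <= j)%N -> circle z ->
  pn p (bmul (perturb_series j z) (fsum a (irange j) z) - bone) <=
  kappa ^+ j * pn p (bone : A).
Proof.
move=> Nj cz; set x := perturb a h0 q (tail_range j) z.
have xE : bmul (q z) (fsum a (irange j) z) = bone - x.
  rewrite /x /perturb h0E -addrA -opprD -bmulDr subKr; congr (bmul _ _).
  by rewrite /fsum (perm_big _ (irange_split Nj)) big_cat.
have -> : bmul (perturb_series j z) (fsum a (irange j) z) - bone =
    - iter j (bmul x) bone.
  by rewrite (geometric_series_left j xE) addrAC subrr add0r.
have x_le : pn p x <= kappa.
  rewrite (le_trans _ kappa_le)// (le_trans (y := rho0 + Q * eta))//.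
    rewrite (le_trans (pnD p_gt0 p_le1 _ _))// lerD ?h0_le// pnN.
    rewrite (le_trans (pnM p_gt0 _ _))// ler_pM ?pn_ge0 ?q_le//.
    rewrite (le_trans (pn_sum p_gt0 p_le1 _ _ _))//.
    rewrite (le_trans _ (fmass_tail_range j))// ler_sum// => n _.
    rewrite pnZ_circle; last exact: circleX.
    by rewrite ler_peMr ?pn_ge0// weight_powR_ge1.
  have eta_ge0 : 0 <= eta by rewrite (le_trans _ (fmass_tail_range 0))// fmass_ge0.
  rewrite ler_peMl ?exprn_ege1// addr_ge0 ?mulr_ge0//.
  exact: le_trans (pn_ge0 _ _) (h0_le circle1).
by rewrite pnN pn_iter_le.
Qed.

End PerturbationSeries.

(** * Left inverses for slowly growing weights below [w] *)

Section LeftInverse.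
Context {R : realType} {A : unitalBanachAlgType R[i]}.
Variables (p : R) (p_gt0 : 0 < p) (p_le1 : p <= 1).
Variables (w : int -> R) (w_weight : weight w) (f : R[i] -> A).
Hypothesis f_conv : p_abs_conv_fourier p w f.
Hypothesis f_inv : forall z, circle z -> exists c, bmul c (f z) = bone.

Notation pn := (pn p).
Local Notation a := (fourier_coef f).

(** The admissible rate [s] is fixed before [nu]: it comes from [q], [N] and the contraction
    constants, all determined using [w]. The weight [nu] can then be chosen to grow slowly
    enough. *)
Lemma weighted_left_inverse : exists2 s : R, 1 < s &
  forall nu, weight nu -> (forall n, nu n <= w n) ->
  (exists C, forall n, nu n <= C * s ^+ `|n|%N) ->
  exists g, [/\ continuous_on_circle g, p_abs_conv_fourier p nu g &
    forall z, circle z -> bmul (g z) (f z) = bone].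
Proof.
have [f_cvg /(pboundP p w a)[Ca HCa]] := f_conv.
have f_tail := fourier_series_pn_tail p_gt0 p_le1 w_weight (fun n => erefl) f_cvg HCa.
have f_lim : laurent_limit f.
  apply: (laurent_limit_pn p_gt0) => e /f_tail[N HN].
  exists N, (fsum a (irange N)); split; last by move=> z; exact: HN.
  apply: laurent_sum => n; rewrite mem_irange => nN.
  exact: leq_laurent nN (laurent_monomial _ _).
have [D [q [Lq q34]]] := approximate_left_inverse f_lim f_inv.
pose Theta : R := (3 / 4) `^ p.
have Theta0 : 0 < Theta by rewrite powR_gt0.
have Theta1 : Theta < 1.
  have : Theta < 1 `^ p by rewrite gt0_ltr_powR ?nnegrE//; lra.
  by rewrite powR1.
have qTheta z : circle z -> pn (bone - bmul (q z) (f z)) <= Theta.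
  by move=> cz; rewrite pn_le// q34.
have [M M0 qM] := laurent_bounded Lq.
pose Q := M `^ p; have Q0 : 0 < Q by rewrite powR_gt0.
have qQ z : circle z -> pn (q z) <= Q by move=> cz; rewrite pn_le ?qM// ltW.
(* [Q * eta] is [(1 - Theta) / 4] and is spent twice, on truncating [f] in [h0] and on the weighted
   tail, so that [rho = (Theta + 1) / 2] stays below 1. *)
pose eta := (1 - Theta) / (4 * Q).
have eta0 : 0 < eta by rewrite divr_gt0 ?mulr_gt0// subr_gt0.
have [N1 HN1] := pbound_tail HCa eta0; have [N2 HN2] := f_tail _ eta0.
pose N := maxn N1 N2; pose d := (D + N)%N.
have L_fN : laurent N (fsum a (irange N)).
  apply: laurent_sum => n; rewrite mem_irange => nN.
  exact: leq_laurent nN (laurent_monomial _ _).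
pose h0 z := bone - bmul (q z) (fsum a (irange N) z).
have Lh0 : laurent d h0.
  by apply: laurentB; [exact: laurent_cst|exact: laurentM].
have Ldq : laurent d q by apply: leq_laurent Lq; rewrite leq_addr.
pose rho0 := Theta + Q * eta.
have h0rho z : circle z -> pn (h0 z) <= rho0.
  move=> cz; have -> : h0 z = (bone - bmul (q z) (f z)) +
      bmul (q z) (f z - fsum a (irange N) z) by rewrite bmulBr addrA subrK.
  rewrite (le_trans (pnD p_gt0 p_le1 _ _))// lerD ?qTheta//.
  rewrite (le_trans (pnM p_gt0 _ _))// ler_pM ?pn_ge0 ?qQ//.
  by rewrite HN2// leq_maxr.
pose rho := rho0 + Q * eta.
have rhoE : rho = (Theta + 1) / 2.
  by rewrite /rho /rho0 /eta; field; rewrite lt0r_neq0.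
have rho_gt0 : 0 < rho by rewrite rhoE; lra.
have rho_lt1 : rho < 1 by rewrite rhoE; lra.
pose kappa := (rho + 1) / 2.
have kappa_lt1 : kappa < 1 by rewrite /kappa; lra.
have rho_kappa : 1 < kappa / rho.
  by rewrite ltr_pdivlMr// mul1r /kappa; lra.
(* [s] is the root of order [2 d + 2] of [kappa / rho], so [sigma ^+ d = s ^+ (2 d)] enlarges [rho]
   to at most [kappa]. The order is positive even for [d = 0]. *)
have [s s1 sE] := exp_root_exists (d.*2.+1) rho_kappa.
have s_ge0 : 0 <= s by rewrite ltW// (lt_trans ltr01).
exists s => // nu nu_weight nuw [C0 nuC].
have nu_ge1 n : 1 <= nu n by case: nu_weight.
have nu_ge0 n : 0 <= nu n by rewrite (le_trans ler01).
have C0_ge0 : 0 <= C0.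
  by have := nuC 0; rewrite expr0 mulr1; apply: le_trans.
have [K1 K1_ge0 HK1] := linear_le_geometric s1.
(* One factor [s ^+ D'] pays for the count of coefficients, the other for the growth of [nu]. *)
pose K := K1 * C0 `^ p; pose sigma := s ^+ 2.
have K_ge0 : 0 <= K by rewrite mulr_ge0 ?powR_ge0.
have sigma_ge1 : 1 <= sigma by rewrite exprn_ege1// ltW.
have growth D' (n : int) : (`|n| <= D')%N ->
    D'.*2.+1%:R * nu n `^ p <= K * sigma ^+ D'.
  move=> nD; have -> : K * sigma ^+ D' = K1 * s ^+ D' * (C0 `^ p * s ^+ D').
    by rewrite /sigma -exprM mulnC exprM expr2 /K; ring.
  rewrite ler_pM ?powR_ge0 ?HK1//.
  rewrite (le_trans (y := (C0 * s ^+ `|n|%N) `^ p))//.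
    by rewrite ge0_ler_powR ?nnegrE ?mulr_ge0 ?exprn_ge0// ltW.
  rewrite powRM ?exprn_ge0// ler_wpM2l ?powR_ge0//.
  rewrite (le_trans (ler1_powR _ p_le1)) ?exprn_ege1 ?(ltW s1)//.
  by rewrite ler_weXn2l// ltW.
have nu_pw n : nu n `^ p <= w n `^ p.
  rewrite ge0_ler_powR ?nnegrE ?(ltW p_gt0)// (le_trans (nu_ge0 n))//.
have a_pbound : pbound p nu a Ca.
  move=> S uS; rewrite (le_trans _ (HCa S uS))// ler_sum// => n _.
  by rewrite ler_wpM2l ?pn_ge0.
have a_tail S : uniq S -> (forall n : int, n \in S -> (N < `|n|)%N) ->
    fmass p nu a S <= eta.
  move=> uS SN; rewrite (le_trans _ (HN1 S uS _))//.
    by rewrite ler_sum// => n _; rewrite ler_wpM2l ?pn_ge0.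
  by move=> n /SN; apply: leq_ltn_trans; rewrite leq_maxl.
have kappa_le : sigma ^+ d * (rho0 + Q * eta) <= kappa.
  rewrite -ler_pdivlMr// -/rho -sE /sigma -exprM mul2n.
  by rewrite ler_weXn2l ?(ltW s1)// leqW.
have mps := multiplier_perturb_series p_gt0 p_le1 nu_weight K_ge0 sigma_ge1
  growth Lh0 Ldq h0rho qQ a_tail kappa_le.
have [j|j|e|g [cg pg Gg]] := pbound_cauchy_limit p_gt0 p_le1 nu_weight
  (G := perturb_series a h0 q N).
- by have [] := mps j.
- by have [C /multiplier_pbound H] : exists C, multiplier p nu sigma
      (perturb_series a h0 q N j) C; [eexists; exact: mps|eexists; exact: H].
- exact: (perturb_series_cauchy p_gt0 p_le1 nu_weight K_ge0 sigma_ge1 growth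
    a_pbound Lh0 Ldq h0rho qQ a_tail kappa_le kappa_lt1).
exists g; split => // z cz; apply/eqP; rewrite -subr_eq0; apply/eqP.
apply/rnorm_eq0/(powR_eq0_eq0 (p := p))/eqP; rewrite eq_le powR_ge0 andbT.
apply/ler_addgt0Pr => e e0; rewrite add0r -/(pn _).
(* [g f - 1] is split as [(g - Gj) f + Gj (f - fj) + (Gj fj - 1)]; with every error at most [e1],
   the total is at most [e1 * (B - 1)]. *)
pose B := pn (f z) + (pn (g z) + 1) + pn (bone : A) + 1.
have B0 : 0 < B by rewrite ltr_wpDl// !addr_ge0// pn_ge0.
pose e1 := Num.min 1 (e / B).
have e1_gt0 : 0 < e1 by rewrite lt_min ltr01 divr_gt0.
have [J1 HJ1] := Gg _ e1_gt0; have [J2 HJ2] := f_tail _ e1_gt0.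
have kappa0 : 0 <= kappa by rewrite /kappa; lra.
have [J3 HJ3] := pow_small kappa0 kappa_lt1 e1_gt0.
pose j := maxn N (maxn J1 (maxn J2 J3)).
have [Nj J1j J2j J3j] : [/\ (N <= j)%N, (J1 <= j)%N, (J2 <= j)%N & (J3 <= j)%N].
  have [m1 m2] := (leq_maxr N (maxn J1 (maxn J2 J3)), leq_maxr J1 (maxn J2 J3)).
  split; first exact: leq_maxl.
  - exact: leq_trans (leq_maxl _ _) m1.
  - exact: leq_trans (leq_trans (leq_maxl _ _) m2) m1.
  - exact: leq_trans (leq_trans (leq_maxr _ _) m2) m1.
have Gj1 := HJ1 j z J1j cz; have fj1 := HJ2 j z J2j cz.
have kj1 := HJ3 j J3j.
set Gj := perturb_series a h0 q N j z in Gj1; set fj := fsum a (irange j) z in fj1.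
have Gj_le : pn Gj <= pn (g z) + 1.
  rewrite -[Gj](subrK (g z)) (le_trans (pnD p_gt0 p_le1 _ _))// addrC lerD2l.
  by rewrite (le_trans Gj1)// ge_min lexx.
have last_le : pn (bmul Gj fj - bone) <= e1 * pn (bone : A).
  rewrite (le_trans (perturb_series_inverse p_gt0 p_le1 nu_weight sigma_ge1 h0rho
    qQ a_tail kappa_le _ Nj cz))//.
  by rewrite ler_wpM2r ?pn_ge0.
have -> : bmul (g z) (f z) - bone = bmul (g z - Gj) (f z) + bmul Gj (f z - fj) +
    (bmul Gj fj - bone).
  by rewrite bmulBl bmulBr !addrA !subrK.
rewrite (le_trans (pnD p_gt0 p_le1 _ _))//.
rewrite (le_trans (lerD (pnD p_gt0 p_le1 _ _) last_le))//.
have t1 : pn (bmul (g z - Gj) (f z)) <= e1 * pn (f z).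
  by rewrite (le_trans (pnM p_gt0 _ _))// ler_wpM2r ?pn_ge0// pnB.
have t2 : pn (bmul Gj (f z - fj)) <= (pn (g z) + 1) * e1.
  by rewrite (le_trans (pnM p_gt0 _ _))// ler_pM ?pn_ge0.
rewrite (le_trans (lerD (lerD t1 t2) (lexx _)))//.
have -> : e1 * pn (f z) + (pn (g z) + 1) * e1 + e1 * pn (bone : A) = e1 * (B - 1).
  by rewrite /B; ring.
rewrite (le_trans (y := e1 * B))//.
  by rewrite ler_wpM2l ?(ltW e1_gt0)// gerBl.
by rewrite -ler_pdivlMr// ge_min lexx orbT.
Qed.

End LeftInverse.

(** * Growth of weights *)

Section WeightGrowth.
Context {R : realType}.
Implicit Types (w nu : int -> R) (r s : R).

Definition subexponential w :=
  forall s, 1 < s -> exists C, forall n, w n <= C * s ^+ `|n|%N.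

Lemma weight_opp w : weight w -> weight (fun n => w (- n)).
Proof. by move=> [w1 wM]; split => // m n; rewrite opprD. Qed.

(** Divide [n] by [n0]: the quotient contributes powers of [u n0], and the remainder is bounded by
    the sum of the values below [n0]. *)
Lemma submultiplicative_growth (u : nat -> R) s n0 :
  (forall n, 1 <= u n) -> (forall m n, u (m + n)%N <= u m * u n) ->
  1 <= s -> (0 < n0)%N -> u n0 <= s ^+ n0 ->
  exists C, forall n, u n <= C * s ^+ n.
Proof.
move=> u1 uM s1 n00 un0; have u0 n : 0 <= u n by rewrite (le_trans ler01).
exists (\sum_(i < n0) u i) => n; rewrite {1 2}(divn_eq n n0).
have lt_mod : (n %% n0 < n0)%N by rewrite ltn_mod.
have um : u (n %% n0)%N <= \sum_(i < n0) u i.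
  by rewrite (bigD1 (Ordinal lt_mod))//= lerDl sumr_ge0.
rewrite exprD mulrA mulrAC; set C := \sum_(i < n0) u i in um *.
have C0 : 0 <= C by exact: le_trans um.
apply: (le_trans (y := C * s ^+ (n %/ n0 * n0))); last first.
  by rewrite mulrAC ler_peMr ?exprn_ege1// mulr_ge0// exprn_ge0// (le_trans ler01).
elim: (n %/ n0)%N => [|k IH]; first by rewrite mul0n add0n expr0 mulr1.
rewrite mulSn -addnA (le_trans (uM _ _))// exprD mulrCA.
by rewrite ler_pM.
Qed.

Lemma weight_growth w s m n : weight w -> 1 <= s -> (0 < m)%N -> (0 < n)%N ->
  w m%:Z <= s ^+ m -> w (- n%:Z) <= s ^+ n ->
  exists C, forall k, w k <= C * s ^+ `|k|%N.
Proof.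
move=> ww s1 m0 n0 wm wn; have [w1 wM] := ww; have [v1 vM] := weight_opp ww.
have [|C1 H1] := @submultiplicative_growth (fun k => w k%:Z) s m
  (fun k => w1 _) _ s1 m0 wm; first by move=> k l; rewrite PoszD; exact: wM.
have [|C2 H2] := @submultiplicative_growth (fun k => w (- k%:Z)) s n
  (fun k => w1 _) _ s1 n0 wn; first by move=> k l; rewrite PoszD; exact: vM.
have C10 : 0 <= C1.
  by have := H1 0%N; rewrite expr0 mulr1; apply: le_trans; rewrite (le_trans ler01).
have C20 : 0 <= C2.
  by have := H2 0%N; rewrite expr0 mulr1; apply: le_trans; rewrite (le_trans ler01).
have sk k : 0 <= s ^+ k by rewrite exprn_ge0// (le_trans ler01).
exists (C1 + C2) => -[] k; rewrite mulrDl.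
  by rewrite (le_trans (H1 k))// lerDl mulr_ge0.
by rewrite NegzE abszN (le_trans (H2 k.+1))// lerDr mulr_ge0.
Qed.

(** Let [s] be a rate at which subexponential growth fails. If [w] fell below the exponential at
    some positive and at some negative integer, [weight_growth] would bound it by that rate; hence
    one half-line stays above. *)
Lemma subexponential_or_exponential w : weight w -> subexponential w \/
  exists2 r, 1 < r & (forall n, r ^+ n <= w n%:Z) \/
                     (forall n, r ^+ n <= w (- n%:Z)).
Proof.
move=> ww; have [w1 _] := ww.
have [|/existsNP[s /not_implyP[s1 nC]]] := pselect (subexponential w); first by left.
right; exists s => //.
have [[m m0 wm]|Hm] := pselect (exists2 m, (0 < m)%N & w m%:Z <= s ^+ m); last first.
  left=> -[|n]; first by rewrite expr0.
  by rewrite leNgt; apply/negP => /ltW wn; apply: Hm; exists n.+1.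
right=> -[|n]; first by rewrite expr0.
rewrite leNgt; apply/negP => /ltW wn; apply: nC.
exact: (weight_growth ww (ltW s1) m0 (ltn0Sn n) wm wn).
Qed.

Lemma root_lt_pow (x s : R) n : (0 < n)%N -> 0 <= x -> 0 <= s ->
  x `^ n%:R^-1 < s -> x <= s ^+ n.
Proof.
move=> n0 x0 s0 xs; have -> : x = (x `^ n%:R^-1) ^+ n.
  by rewrite -powR_mulrn ?powR_ge0// -powRrM mulVf ?powRr1// pnatr_eq0 -lt0n.
by rewrite lerXn2r ?nnegrE ?powR_ge0// ltW.
Qed.

(** [rho2 w = 1] yields [m] with [w m] at most [s ^+ m], and [rho1 w = 1] yields [n] with [w (- n)]
    at most [s ^+ n]; [weight_growth] extends these two values to all integers. *)
Lemma admissible_subexponential w : weight w -> admissible w -> subexponential w.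
Proof.
move=> ww [r1 r2] s s1; have [w1 _] := ww.
have w0 n : 0 <= w n by rewrite (le_trans ler01).
have s0 : 0 < s by rewrite (lt_trans ltr01).
have [m m0 wm] : exists2 m, (0 < m)%N & w m%:Z <= s ^+ m.
  have [||_ [m m0 <-]] := @inf_adherent R
    [set w n%:Z `^ n%:R^-1 | n in [set n : nat | (0 < n)%N]] (s - 1).
  - by rewrite subr_gt0.
  - split; first by exists (w 1 `^ 1%:R^-1), 1%N.
    by exists 0 => _ [n _ <-]; exact: powR_ge0.
  rewrite -/(rho2 w) r2 subrKC => H; exists m => //.
  exact: root_lt_pow m0 (w0 _) (ltW s0) H.
have [n n0 wn] : exists2 n, (0 < n)%N & w (- n%:Z) <= s ^+ n.
  have [||_ [n n0 <-]] := @sup_adherent R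
    [set w (- n%:Z) `^ (- n%:R^-1) | n in [set n : nat | (0 < n)%N]] (1 - s^-1).
  - by rewrite subr_gt0 invf_lt1.
  - split; first by exists (w (- 1) `^ (- 1%:R^-1)), 1%N.
    exists 1 => _ [n _ <-]; rewrite -[leRHS](powRr0 (w (- n%:Z))) ler_powR//.
  rewrite -/(rho1 w) r1 subKr powRN ltf_pV2 ?posrE ?powR_gt0//; last first.
    by rewrite (lt_le_trans ltr01).
  move=> H; exists n => //; exact: root_lt_pow n0 (w0 _) (ltW s0) H.
exact: weight_growth ww (ltW s1) m0 n0 wm wn.
Qed.

Lemma constant_subexponential w : weight w -> constant_weight w -> subexponential w.
Proof.
move=> [w1 _] [c wc] s s1; exists c => n; rewrite wc ler_peMr ?exprn_ege1 ?(ltW s1)//.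
by rewrite -(wc 0) (le_trans ler01).
Qed.

Definition pos_part (n : int) : nat := if n is Posz k then k else 0%N.

(** Equal to 1 on negative integers, where [w] is only known to be at least 1. *)
Definition one_sided r (n : int) : R := r ^+ pos_part n.

Lemma one_sided_weight r : 1 <= r -> weight (one_sided r).
Proof.
move=> r1; split => [n|m n]; first exact: exprn_ege1.
rewrite -exprD ler_weXn2l//.
have H k (i : int) : i <= k%:Z -> (pos_part i <= k)%N by case: i.
have le_pos (i : int) : i <= (pos_part i)%:Z by case: i.
by apply: H; rewrite PoszD lerD.
Qed.

Lemma one_sided_not_constant r : 1 < r -> ~ constant_weight (one_sided r).
Proof.
move=> r1 [c H]; have h0 : r ^+ 0 = c := H 0; have h1 : r ^+ 1 = c := H 1.
by move: r1; rewrite -[r]expr1 h1 -h0 expr0 ltxx.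
Qed.

Lemma one_sided_le r s n : 1 <= r -> r <= s -> one_sided r n <= 1 * s ^+ `|n|%N.
Proof.
move=> r1 rs; rewrite mul1r (le_trans (y := s ^+ pos_part n))//.
  by rewrite lerXn2r ?nnegrE// ?(le_trans ler01)// (le_trans r1).
by rewrite ler_weXn2l ?(le_trans r1)//; case: n.
Qed.

Lemma one_sided_le_weight r w : weight w -> 1 <= r ->
  (forall n, r ^+ n <= w n%:Z) -> forall n, one_sided r n <= w n.
Proof. by move=> [w1 _] r1 rw [n|n]; [exact: rw|exact: w1]. Qed.

Lemma slow_minorant w s : weight w -> ~ subexponential w -> 1 < s ->
  exists nu, [/\ weight nu, (forall n, nu n <= w n), ~ constant_weight nu &
    exists C, forall n, nu n <= C * s ^+ `|n|%N].
Proof.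
move=> ww nw s1; have [//|[r r1 H]] := subexponential_or_exponential ww.
(* [t <= r] keeps the minorant below [w], and [t <= s] keeps its growth within the allowed rate. *)
pose t := Num.min r s; have t1 : 1 < t by rewrite lt_min r1.
have t1' := ltW t1; have tr : t <= r by rewrite ge_min lexx.
have trX n : t ^+ n <= r ^+ n.
  by rewrite lerXn2r ?nnegrE// (le_trans ler01)// ltW.
have ts : t <= s by rewrite ge_min lexx orbT.
case: H => H.
- exists (one_sided t); split; [exact: one_sided_weight| |exact: one_sided_not_constant|].
    by apply: one_sided_le_weight => // n; rewrite (le_trans (trX n)).
  by exists 1 => n; exact: one_sided_le.
- exists (fun n => one_sided t (- n)); split.
  + exact/weight_opp/one_sided_weight.
  + move=> n; rewrite -[in leRHS](opprK n).
    apply: (one_sided_le_weight (weight_opp ww)) => // k.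
    exact: le_trans (trX k) (H k).
  + by move=> [c Hc]; apply: (one_sided_not_constant t1); exists c => n; rewrite -(opprK n).
  + by exists 1 => n; rewrite -abszN; exact: one_sided_le.
Qed.

End WeightGrowth.

Lemma left_inverse_theorem (R : realType) (A : unitalBanachAlgType R[i]) (p : R)
    (w : int -> R) (f : R[i] -> A) :
  0 < p -> p <= 1 -> weight w -> p_abs_conv_fourier p w f ->
  (forall z, circle z -> exists c, bmul c (f z) = bone) ->
  (exists (nu : int -> R) (g : R[i] -> A),
    [/\ weight nu, continuous_on_circle g, (forall n, 1 <= nu n /\ nu n <= w n),
        (constant_weight nu <-> constant_weight w) &
        p_abs_conv_fourier p nu g /\
        (forall z, circle z -> bmul (g z) (f z) = bone)]) /\
  (admissible w ->
   exists g : R[i] -> A,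
    [/\ continuous_on_circle g, p_abs_conv_fourier p w g &
        forall z, circle z -> bmul (g z) (f z) = bone]).
Proof.
move=> p0 p1 ww fw finv; have [s s1 H] := weighted_left_inverse p0 p1 ww fw finv.
have Hsub : subexponential w -> exists g : R[i] -> A,
    [/\ continuous_on_circle g, p_abs_conv_fourier p w g &
        forall z, circle z -> bmul (g z) (f z) = bone].
  by move=> sw; apply: (H w ww) => // ; exact: sw.
split; last by move=> /(admissible_subexponential ww).
have [/Hsub[g [cg pg gf]]|nsw] := pselect (subexponential w).
  by exists w, g; split => // n; split => //; case: ww.
have [nu [wnu nuw nuc nuC]] := slow_minorant ww nsw s1.
have [g [cg pg gf]] := H nu wnu nuw nuC.
exists nu, g; split => //; first by move=> n; split => //; case: wnu.
(* Both sides of the equivalence are false: [nu] is not constant, and a constant [w] would be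
   subexponential. *)
by split => // /(constant_subexponential ww).
Qed.

(** * The opposite algebra, and the three kinds of inverse *)

Definition opposite (K : numFieldType) (A : unitalBanachAlgType K) : Type := A.

HB.instance Definition _ (K : numFieldType) (A : unitalBanachAlgType K) :=
  CompleteNormedModule.copy (opposite A) A.

Section OppositeAlgebra.
Context {K : numFieldType} {A : unitalBanachAlgType K}.
Implicit Types x y z : opposite A.

Definition opposite_mul x y : opposite A := bmul (y : A) (x : A).

Lemma opposite_mulA : associative opposite_mul.
Proof. by move=> x y z; rewrite /opposite_mul bmulA. Qed.

Lemma opposite_normM x y : `|opposite_mul x y| <= `|x| * `|y|.
Proof. by rewrite mulrC; exact: normr_bmul. Qed.

HB.instance Definition _ :=
  CompleteNormedModule_isBanachAlgebra.Build K (opposite A)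
    opposite_mulA (fun x => bmulx1 (x : A)) (fun x => bmul1x (x : A))
    (fun x y z => bmulDr (z : A) x y) (fun x y z => bmulDl (y : A) z x)
    (fun a x y => bscalerAr a (y : A) x) (fun a x y => bscalerAl a (y : A) x)
    opposite_normM.

End OppositeAlgebra.

Theorem theorem1 (R : realType) (A : unitalBanachAlgType R[i]) (p : R)
    (w : int -> R) (f : R[i] -> A) (s : side) :
  0 < p -> p <= 1 ->
  weight w ->
  continuous_on_circle f ->
  p_abs_conv_fourier p w f ->
  (forall z, circle z -> is_invertible s (f z)) ->
  (exists (nu : int -> R) (g : R[i] -> A),
    [/\ weight nu,
        continuous_on_circle g,
        (forall n, 1 <= nu n /\ nu n <= w n),
        (constant_weight nu <-> constant_weight w) &
        p_abs_conv_fourier p nu g /\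
        (forall z, circle z -> is_inverse s (f z) (g z))])
  /\
  (admissible w ->
   exists g : R[i] -> A,
    [/\ continuous_on_circle g,
        p_abs_conv_fourier p w g &
        forall z, circle z -> is_inverse s (f z) (g z)]).
Proof.
move=> p0 p1 ww _ fw finv; case: s finv => finv.
- exact: left_inverse_theorem.
(* [opposite A] shares the normed module of [A], so all Fourier data agree by conversion, and only
   the order of products changes. *)
- exact: (@left_inverse_theorem R (opposite A) p w f p0 p1 ww fw finv).
(* Where [f z] has a two-sided inverse [y], a left inverse equals [y], because
   [g = g (f y) = (g f) y = y]. *)
- have two_sided (g : R[i] -> A) : (forall z, circle z -> bmul (g z) (f z) = bone) ->
      forall z, circle z -> is_inverse TwoSided (f z) (g z).
    move=> gf z cz; split; first exact: gf.
    have [y [yf fy]] := finv z cz.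
    suff -> : g z = y by [].
    by rewrite -[g z]bmulx1 -fy bmulA gf// bmul1x.
  have [|[nu [g [H1 H2 H3 H4 [H5 /two_sided H6]]]] H] :=
      left_inverse_theorem p0 p1 ww fw.
    by move=> z /finv[y [yf _]]; exists y.
  split; first by exists nu, g.
  by move=> /H[g' [K1 K2 /two_sided K3]]; exists g'.
Qed.
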